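(* $(\mu,(\boldsymbol u,\widehat{\boldsymbol u}))$ is an eigenpair of $\boldsymbol T$ (i.e. $\boldsymbol T(\boldsymbol u,\widehat{\boldsymbol u})=\mu(\boldsymbol u,\widehat{\boldsymbol u})$ with $(\boldsymbol u,\widehat{\boldsymbol u})\ne\boldsymbol 0$) with $\mu\neq0$ if and only if $(\lambda,(\boldsymbol u,\widehat{\boldsymbol u}))$, with $\lambda=1/\mu\neq0$, is a solution of the following problem: find $\lambda\in\mathbb C$ and $\boldsymbol 0\neq(\boldsymbol u,\widehat{\boldsymbol u})\in\mathcal V\times\mathcal H$ such that $$\int_\Omega\rho c^2\,\mathrm{div}\,\boldsymbol u\,\mathrm{div}\,\overline{\boldsymbol v}=\lambda\left(-2\int_\Omega\nu\,\mathrm{div}\,\boldsymbol u\,\mathrm{div}\,\overline{\boldsymbol v}-\int_\Omega\rho\,\widehat{\boldsymbol u}\cdot\overline{\boldsymbol v}\right)\quad\forall\boldsymbol v\in\mathcal V,$$ $$\int_\Omega\rho\,\widehat{\boldsymbol u}\cdot\overline{\widehat{\boldsymbol v}}=\lambda\int_\Omega\rho\,\boldsymbol u\cdot\overline{\widehat{\boldsymbol v}}\quad\forall\widehat{\boldsymbol v}\in\mathcal H.$$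
   Context: Setting: $d\in\{2,3\}$; $\Omega_1,\Omega_2\subset\mathbb R^d$ are disjoint bounded polygonal ($d=2$) or polyhedral ($d=3$) Lipschitz domains; $\Omega:=(\overline\Omega_1\cup\overline\Omega_2)^\circ$ is a bounded Lipschitz domain with outer unit normal $\boldsymbol n$; $\Omega_1,\Omega_2,\Omega$ are simply connected. $\rho,c,\nu$ are the functions on $\Omega$ equal to constants $\rho_i>0$, $c_i>0$, $\nu_i\ge 0$ on $\Omega_i$, $i=1,2$. All function spaces are complex. $\mathcal H:=L^2(\Omega)^d$ with inner product $(\boldsymbol v,\boldsymbol w)_{\mathcal H}:=\int_\Omega\rho\,\boldsymbol v\cdot\overline{\boldsymbol w}$. $\mathcal V:=H_0(\mathrm{div};\Omega)=\{\boldsymbol v\in L^2(\Omega)^d:\mathrm{div}\,\boldsymbol v\in L^2(\Omega),\ \boldsymbol v\cdot\boldsymbol n=0\text{ on }\partial\Omega\}$ with inner product $(\boldsymbol v,\boldsymbol w)_{\mathcal V}:=\int_\Omega\rho\,\boldsymbol v\cdot\overline{\boldsymbol w}+\int_\Omega\rho c^2\,\mathrm{div}\,\boldsymbol v\,\mathrm{div}\,\overline{\boldsymbol w}$. $\mathcal K:=\{\boldsymbol v\in\mathcal V:\mathrm{div}\,\boldsymbol v=0\text{ in }\Omega\}$, and $\mathcal G$ is the orthogonal complement of $\mathcal K$ in $\mathcal V$ (for $(\cdot,\cdot)_{\mathcal V}$; equivalently for $(\cdot,\cdot)_{\mathcal H}$). $\widetilde{\mathcal V}:=\mathcal V\times\mathcal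 H$ with the product norm, $\widetilde{\mathcal G}:=\mathcal G\times\mathcal H$. Forms on $\widetilde{\mathcal V}$: $\widetilde a((\boldsymbol u,\widehat{\boldsymbol u}),(\boldsymbol v,\widehat{\boldsymbol v})):=\int_\Omega\rho c^2\,\mathrm{div}\,\boldsymbol u\,\mathrm{div}\,\overline{\boldsymbol v}+\int_\Omega\rho\,\widehat{\boldsymbol u}\cdot\overline{\widehat{\boldsymbol v}}$ and $\widetilde b((\boldsymbol u,\widehat{\boldsymbol u}),(\boldsymbol v,\widehat{\boldsymbol v})):=-2\int_\Omega\nu\,\mathrm{div}\,\boldsymbol u\,\mathrm{div}\,\overline{\boldsymbol v}-\int_\Omega\rho\,\widehat{\boldsymbol u}\cdot\overline{\boldsymbol v}+\int_\Omega\rho\,\boldsymbol u\cdot\overline{\widehat{\boldsymbol v}}$. $\boldsymbol T:\widetilde{\mathcal V}\to\widetilde{\mathcal V}$ is the bounded operator $\boldsymbol T(\boldsymbol f,\boldsymbol g):=(\boldsymbol u,\widehat{\boldsymbol u})$, the unique element of $\widetilde{\mathcal G}$ with $\widetilde a((\boldsymbol u,\widehat{\boldsymbol u}),(\boldsymbol v,\widehat{\boldsymbol v}))=\widetilde b((\boldsymbol f,\boldsymbol g),(\boldsymbol v,\widehat{\boldsymbol v}))$ for all $(\boldsymbol v,\widehat{\boldsymbol v})\in\widetilde{\mathcal G}$. *)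

(* Defs.v *)
From HB Require Import structures.
From mathcomp Require Import all_boot all_order all_algebra.
From mathcomp Require Import complex.
From mathcomp Require Import all_classical all_reals all_analysis.

Set Implicit Arguments.
Unset Strict Implicit.
Unset Printing Implicit Defensive.
Import Order.TTheory GRing.Theory Num.Theory.
Import numFieldNormedType.Exports.
Local Open Scope classical_set_scope.
Local Open Scope ring_scope.
Local Open Scope complex_scope.

(* The sigma-algebra generated by the coordinates; it is the Borel sigma-algebra
   of ['rV[R]_n]. *)
Definition measure_rV_display : measure_display.
Proof. exact: default_measure_display. Qed.

Section measurable_rV.
Context {R : realType} (n : nat).

Let coors : 'I_n -> 'rV[R]_n -> R := fun i x => x ord0 i.

Let rV_set0 : g_sigma_preimage coors set0.
Proof. exact: sigma_algebra0. Qed.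

Let rV_setC A : g_sigma_preimage coors A -> g_sigma_preimage coors (~` A).
Proof. exact: sigma_algebraC. Qed.

Let rV_bigcup (F : (set 'rV[R]_n)^nat) :
  (forall i, g_sigma_preimage coors (F i)) ->
  g_sigma_preimage coors (\bigcup_i (F i)).
Proof. exact: sigma_algebra_bigcup. Qed.

HB.instance Definition _ := @isMeasurable.Build measure_rV_display
  'rV[R]_n (g_sigma_preimage coors) rV_set0 rV_setC rV_bigcup.

End measurable_rV.

Section lebesgue_rV.
Context {R : realType}.

Lemma measurable_fun_rV d (T : measurableType d) n (f : T -> 'rV[R]_n) :
  (forall i, measurable_fun setT (fun x => f x ord0 i)) ->
  measurable_fun setT f.
Proof.
move=> mf.
suff H : preimage_set_system setT f measurable `<=` measurable.
  by move=> _ Y mY; apply: H; exists Y.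
rewrite -[X in preimage_set_system _ _ X]/(g_sigma_preimage _).
rewrite -g_sigma_preimage_comp.
apply: smallest_sub; first exact: sigma_algebra_measurable.
case: n => [|n] in f mf *; first by rewrite big_ord0.
rewrite -bigcup_mkord_ord; apply: bigcup_sub => i Ii.
by move=> A [B mB <-]; exact: mf.
Qed.

Definition rV_rcons n (p : 'rV[R]_n * R) : 'rV[R]_n.+1 :=
  \row_i (if unlift ord_max i is Some j then p.1 ord0 j else p.2).

Lemma measurable_coord n (i : 'I_n) :
  measurable_fun setT (fun x : 'rV[R]_n => x ord0 i).
Proof.
move=> _ Y mY; rewrite setTI; apply: sub_sigma_algebra => /=.
rewrite -bigcup_seq/=; exists i => /=; first by rewrite mem_index_enum.
by exists Y => //; rewrite setTI.
Qed.

Lemma measurable_rV_rcons n : measurable_fun setT (@rV_rcons n).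
Proof.
apply: measurable_fun_rV => i; rewrite /rV_rcons.
under eq_fun do rewrite mxE.
case: unliftP => [j _|_]; last exact: measurable_snd.
exact: (measurableT_comp (measurable_coord j) measurable_fst).
Qed.

(* The [n]-fold product of the one-dimensional Lebesgue measure. *)
Fixpoint lebesgue_rV n : set 'rV[R]_n -> \bar R :=
  match n return set 'rV[R]_n -> \bar R with
  | 0%N => @dirac _ _ (0 : 'rV[R]_0) R
  | n'.+1 =>
    pushforward (lebesgue_rV (n := n') \x lebesgue_measure)%E
      (@rV_rcons n')
  end.

Lemma lebesgue_rV_isMeasure n :
  [/\ @lebesgue_rV n set0 = 0%E, (forall A, 0 <= @lebesgue_rV n A)%E
    & semi_sigma_additive (@lebesgue_rV n)].
Proof.
elim: n => [|n [m0 m_ge0 m_sadd]].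
  by split=> [|A|]; [exact: measure0 | exact: measure_ge0
    | exact: measure_semi_sigma_additive].
pose m := HB.pack_for {measure set 'rV[R]_n -> \bar R} (@lebesgue_rV n)
  (isMeasure.Build _ _ _ (@lebesgue_rV n) m0 m_ge0 m_sadd).
pose p : {measure set ('rV[R]_n * measurableTypeR R) -> \bar R} :=
  (m \x lebesgue_measure)%E.
have p0 : p set0 = 0%E by exact: measure0.
split => /=.
- by rewrite /pushforward preimage_set0; exact: p0.
- by move=> A; exact: (measure_ge0 p).
- move=> F mF tF mUF; rewrite /pushforward preimage_bigcup.
  apply: (@measure_semi_sigma_additive _ _ _ p) => //.
  + by move=> k; rewrite -[X in measurable X]setTI; exact: measurable_rV_rcons.
  + apply/trivIsetP => /= i j _ _ ij; rewrite -preimage_setI.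
    by move/trivIsetP : tF => /(_ _ _ _ _ ij) ->//; rewrite preimage_set0.
  + rewrite -preimage_bigcup -[X in measurable X]setTI.
    exact: measurable_rV_rcons.
Qed.

HB.instance Definition _ n := isMeasure.Build _ _ _ (@lebesgue_rV n)
  (let: And3 h _ _ := lebesgue_rV_isMeasure n in h)
  (let: And3 _ h _ := lebesgue_rV_isMeasure n in h)
  (let: And3 _ _ h := lebesgue_rV_isMeasure n in h).

End lebesgue_rV.
Arguments lebesgue_rV {R} n.

Section domains.
Context {R : realType} {d : nat}.
Implicit Types (Omega : set 'rV[R]_d) (x y : 'rV[R]_d).

Definition dot x y : R := \sum_i x ord0 i * y ord0 i.

Definition bounded_domain Omega :=
  [/\ open Omega, connected Omega, Omega !=set0 & bounded_set Omega].

Definition boundary Omega : set 'rV[R]_d := closure Omega `\` Omega°.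

(* Near each boundary point, [Omega] is the strict subgraph of a Lipschitz
   function, in the direction of some Euclidean unit vector [e]; the variable
   of the graph function is the orthogonal projection on the hyperplane
   orthogonal to [e]. *)
Definition lipschitz_boundary Omega :=
  forall x0, boundary Omega x0 ->
  exists (e : 'rV[R]_d) (gamma : 'rV[R]_d -> R) (L : R),
    [/\ dot e e = 1,
        (forall x y, `|gamma x - gamma y| <= L * `|x - y|)
      & \forall x \near x0,
          Omega x <-> dot x e < gamma (x - dot x e *: e)].

(* [convex_face h s] is cut out of the hyperplane [dot h.1 x = h.2] by the
   finitely many closed half-spaces [dot k.1 x <= k.2], [k \in s]. *)
Definition convex_face (h : 'rV[R]_d * R) (s : seq ('rV[R]_d * R)) :
    set 'rV[R]_d :=
  [set x | dot h.1 x = h.2 /\ forall k, k \in s -> dot k.1 x <= k.2].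

(* The boundary is a finite union of convex flat faces: segments in the plane,
   convex polygons in space. The faces of a bounded set are bounded. *)
Definition polyhedral_boundary Omega :=
  exists F : seq (('rV[R]_d * R) * seq ('rV[R]_d * R)),
    (forall f, f \in F -> f.1.1 != 0) /\
    boundary Omega = [set x | exists2 f, f \in F & convex_face f.1 f.2 x].

Local Notation I := [set` `[0 : R, 1]].

(* Every loop in [Omega] is contractible in [Omega], with fixed base point. *)
Definition simply_connected Omega :=
  forall gamma : R -> 'rV[R]_d,
    {within I, continuous gamma} ->
    (forall t, I t -> Omega (gamma t)) ->
    gamma 0 = gamma 1 ->
  exists H : R * R -> 'rV[R]_d,
    [/\ {within I `*` I, continuous H},
        (forall s t, I s -> I t -> Omega (H (s, t))),
        (forall t, I t -> H (0, t) = gamma t),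
        (forall t, I t -> H (1, t) = gamma 0)
      & (forall s, I s -> H (s, 0) = gamma 0 /\ H (s, 1) = gamma 0)].

Definition lipschitz_domain Omega :=
  bounded_domain Omega /\ lipschitz_boundary Omega.

Definition polyhedral_domain Omega :=
  lipschitz_domain Omega /\ polyhedral_boundary Omega.

Definition glued_domain (Omega1 Omega2 : set 'rV[R]_d) : set 'rV[R]_d :=
  (closure Omega1 `|` closure Omega2)°.

(* The function equal to [a1] on [Omega1] and to [a2] on [Omega2]. The
   rest of [glued_domain Omega1 Omega2], the interface, is negligible, so that
   the value there is immaterial; it is [a2]. *)
Definition piecewise (Omega1 : set 'rV[R]_d) (a1 a2 : R) : 'rV[R]_d -> R :=
  fun x => if x \in Omega1 then a1 else a2.

End domains.

(* Elements of the spaces are represented by functions on the whole of [R^d],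
   two functions being identified when they agree almost everywhere on
   [Omega]. *)
Notation scalar_field R d := ('rV[R]_d -> R[i]).
Notation vector_field R d := ('rV[R]_d -> 'rV[R[i]]_d).

Section spaces.
Context {R : realType} {d : nat}.
Variable Omega : set 'rV[R]_d.
Local Notation mu := (lebesgue_rV d : {measure set 'rV[R]_d -> \bar R}).
Implicit Types (q phi : scalar_field R d) (u v w : vector_field R d).

Definition cintegral q : R[i] :=
  Complex (\int[mu]_(x in Omega) complex.Re (q x))
    (\int[mu]_(x in Omega) complex.Im (q x)).

Definition L2 q :=
  [/\ measurable_fun Omega (fun x => complex.Re (q x)),
      measurable_fun Omega (fun x => complex.Im (q x))
    & (\int[mu]_(x in Omega)
         (complex.Re (q x) ^+ 2 + complex.Im (q x) ^+ 2)%:E < +oo)%E].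

Definition L2v v := forall i, L2 (fun x => v x ord0 i).

Definition ev (i : 'I_d) : 'rV[R]_d := delta_mx ord0 i.

Fixpoint Ck (k : nat) (f : 'rV[R]_d -> R) : Prop :=
  continuous f /\
  if k is k'.+1 then
    forall i, (forall x, derivable f x (ev i)) /\ Ck k' ('D_(ev i) f)
  else True.

Definition test_function (f : 'rV[R]_d -> R) :=
  [/\ forall k, Ck k f,
      compact (closure [set x | f x != 0])
    & closure [set x | f x != 0] `<=` Omega].

Definition is_weak_div v q :=
  forall f, test_function f ->
    cintegral (fun x => \sum_i v x ord0 i * ('D_(ev i) f x)%:C) =
    - cintegral (fun x => q x * (f x)%:C).

Definition is_weak_grad phi w :=
  forall f, test_function f -> forall i,
    cintegral (fun x => phi x * ('D_(ev i) f x)%:C) =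
    - cintegral (fun x => w x ord0 i * (f x)%:C).

(* The divergence of [v] when it is in [L^2(Omega)], unique up to a negligible
   set. *)
Definition weak_div v : scalar_field R d :=
  xget (fun=> 0) [set q | L2 q /\ is_weak_div v q].

Definition Hdiv v := L2v v /\ exists q, L2 q /\ is_weak_div v q.

(* The normal trace of [v] in [H(div; Omega)] is the functional
   [phi |-> \int v . grad phi + \int div v * phi] on the traces of [H^1(Omega)];
   this says that it vanishes. *)
Definition normal_trace_zero v :=
  forall phi w, L2 phi -> L2v w -> is_weak_grad phi w ->
    cintegral (fun x => \sum_i v x ord0 i * w x ord0 i) +
    cintegral (fun x => weak_div v x * phi x) = 0.

Definition H0div v := Hdiv v /\ normal_trace_zero v.

End spaces.

Section operator.
Context {R : realType} {d : nat}.
Variables (Omega : set 'rV[R]_d) (rho c nu : 'rV[R]_d -> R).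
Local Notation mu := (lebesgue_rV d : {measure set 'rV[R]_d -> \bar R}).
Local Notation field := (vector_field R d).
Implicit Types (u v w : field) (p q f : field * field).

Definition mass v w : R[i] := cintegral Omega (fun x =>
  (rho x)%:C * \sum_i v x ord0 i * conjc (w x ord0 i)).

(* The divergence of [conj w] is [conj (div w)]. *)
Definition divdiv (a : 'rV[R]_d -> R) v w : R[i] := cintegral Omega (fun x =>
  (a x)%:C * (weak_div Omega v x * conjc (weak_div Omega w x))).

Definition rhoc2 (x : 'rV[R]_d) : R := rho x * c x ^+ 2.

Definition spaceH : set field := [set v | L2v Omega v].
Definition spaceV : set field := [set v | H0div Omega v].

Definition innerV v w : R[i] := mass v w + divdiv rhoc2 v w.

Definition spaceK : set field :=
  [set v | spaceV v /\ {ae mu, forall x, Omega x -> weak_div Omega v x = 0}].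
Definition spaceG : set field :=
  [set v | spaceV v /\ forall k, spaceK k -> innerV v k = 0].

Definition tildeV : set (field * field) := spaceV `*` spaceH.
Definition tildeG : set (field * field) := spaceG `*` spaceH.

Definition tilde_a p q : R[i] := divdiv rhoc2 p.1 q.1 + mass p.2 q.2.
Definition tilde_b p q : R[i] :=
  - 2 * divdiv nu p.1 q.1 - mass p.2 q.1 + mass p.1 q.2.

(* The operator [T]: for [f] in [tildeV], a representative of the element of
   [tildeG] which solves the variational equation, and which is unique up to
   equality almost everywhere. The default value of [xget] is only there to make
   the definition total: a solution exists for every [f] in [tildeV], since
   [tilde_a] is coercive on [tildeG]. *)
Definition solution_op f : field * field :=
  xget (fun=> 0, fun=> 0)
    [set p | tildeG p /\ forall q, tildeG q -> tilde_a p q = tilde_b f q].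

Definition ae_pair_eq p q :=
  {ae mu, forall x, Omega x -> p.1 x = q.1 x} /\
  {ae mu, forall x, Omega x -> p.2 x = q.2 x}.

Definition pair_scale (z : R[i]) p : field * field :=
  (fun x => z *: p.1 x, fun x => z *: p.2 x).

Definition nonzero p := ~ ae_pair_eq p (fun=> 0, fun=> 0).

Definition eigenpair (z : R[i]) p :=
  [/\ tildeV p, nonzero p & ae_pair_eq (solution_op p) (pair_scale z p)].

Definition problem_solution (lambda : R[i]) p :=
  [/\ tildeV p, nonzero p,
      (forall v, spaceV v ->
         divdiv rhoc2 p.1 v =
         lambda * (- 2 * divdiv nu p.1 v - mass p.2 v))
    & (forall v, spaceH v -> mass p.2 v = lambda * mass p.1 v)].

End operator.

(* Main.v *)
Require Import Defs.
From mathcomp Require Import all_boot all_order all_algebra.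
From mathcomp Require Import complex.
From mathcomp Require Import all_classical all_reals all_analysis.
From mathcomp Require Import measurable_realfun ring lra.

(** Write (lambda, p) with p = (u, u^) and mu = 1 / lambda.  Testing the equation
    of T with pairs (0, v^) gives the second equation of the problem, since v^
    ranges over all of H on both sides.  The first equation of the problem is
    tested on the whole of V, the one of T only on G, so the content of the
    theorem is that the two agree on K as well and that V = G + K.

    On K every term with a divergence disappears, and what is left of the first
    equation is the orthogonality of u^ to K.  For an eigenvector of T, u is in
    G, hence orthogonal to K, and u^ is the multiple lambda u of u.  Conversely,
    a solution of the problem has u^ orthogonal to K by the first equation, and
    u = u^ / lambda by the second, so that u is in G; then mu p solves the
    variational equation which defines T p, and [is_solution_unique] identifies
    it with T p.  Uniqueness holds because the form tilde_a is definite on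
    G x H: a field of G without divergence is in K and orthogonal to itself.

    Two facts of analysis make this rigorous.

    The divergence of a field is chosen among its weak divergences, so even its
    linearity requires the uniqueness of weak divergences almost everywhere.
    This is the fundamental lemma of the calculus of variations
    ([du_bois_reymond]): products of functions built on exp (-1/t) are test
    functions which converge boundedly to the indicator of a box, so a function
    orthogonal to all test functions has integral zero on boxes, hence on all
    measurable subsets of a box, hence is zero almost everywhere.

    The decomposition V = G + K ([spaceV_decomposition]) is an orthogonal
    projection onto K in the weighted L2 product.  K is the annihilator in L2 of
    a set of L2 fields, the gradients of test functions and the weak gradients,
    so it is closed; the projection then exists ([orthogonal_projection])
    because L2 is complete ([sq_integrable_complete]). *)

Set Implicit Arguments.
Unset Strict Implicit.
Unset Printing Implicit Defensive.
Import Order.TTheory GRing.Theory Num.Theory.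
Import numFieldNormedType.Exports.
Local Open Scope classical_set_scope.
Local Open Scope ring_scope.
Local Open Scope complex_scope.
Local Notation Re := complex.Re.
Local Notation Im := complex.Im.

(** * Boxes, open sets and Lebesgue measure *)

Section boxes.
Context {R : realType} {d : nat}.
Implicit Types (a b x : 'rV[R]_d) (U : set 'rV[R]_d).

Definition obox a b : set 'rV[R]_d :=
  [set x | forall i, a ord0 i < x ord0 i < b ord0 i].
Definition cbox a b : set 'rV[R]_d :=
  [set x | forall i, a ord0 i <= x ord0 i <= b ord0 i].

Lemma obox_cbox a b : obox a b `<=` cbox a b.
Proof. by move=> x h i; have /andP[/ltW -> /ltW ->] := h i. Qed.

Lemma oboxI a b a' b' : obox a b `&` obox a' b' =
  obox (\row_i Num.max (a ord0 i) (a' ord0 i))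
       (\row_i Num.min (b ord0 i) (b' ord0 i)).
Proof.
apply/seteqP; split => [x [h h'] i|x h].
  by rewrite !mxE gt_max lt_min; have /andP[-> ->] := h i; have /andP[-> ->] := h' i.
split => i; have := h i; rewrite !mxE gt_max lt_min => /andP[/andP[h1 h2] /andP[h3 h4]].
  by rewrite h1 h3.
by rewrite h2 h4.
Qed.

Lemma measurable_coords (Y : 'I_d -> set R) : (forall i, measurable (Y i)) ->
  measurable [set x : 'rV[R]_d | forall i, Y i (x ord0 i)].
Proof.
move=> mY; rewrite (_ : mkset _ =
    \bigcap_(i in [set: 'I_d]) ((fun x : 'rV[R]_d => x ord0 i) @^-1` Y i)).
  by apply: fin_bigcap_measurable => // i _; rewrite -[X in measurable X]setTI;
    exact: measurable_coord.
by apply/seteqP; split => [x h i _|x h i]; [exact: h|exact: (h i I)].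
Qed.

Lemma measurable_obox a b : measurable (obox a b).
Proof.
have -> : obox a b = [set x | forall i, `]a ord0 i, b ord0 i[%classic (x ord0 i)].
  by apply/seteqP; split => x /= h i; have := h i; rewrite in_itv.
apply: (@measurable_coords (fun i => _)) => i; exact: measurable_itv.
Qed.

Lemma measurable_cbox a b : measurable (cbox a b).
Proof.
have -> : cbox a b = [set x | forall i, `[a ord0 i, b ord0 i]%classic (x ord0 i)].
  by apply/seteqP; split => x /= h i; have := h i; rewrite in_itv.
apply: (@measurable_coords (fun i => _)) => i; exact: measurable_itv.
Qed.

Lemma compact_cbox a b : compact (cbox a b).
Proof.
have -> : cbox a b = [set x | forall i, `[a ord0 i, b ord0 i]%classic (x ord0 i)].
  by apply/seteqP; split => x /= h i; have := h i; rewrite in_itv.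
apply: (@rV_compact R d (fun i => `[a ord0 i, b ord0 i]%classic)) => i.
exact: segment_compact.
Qed.

Definition rat_corners (n : nat) : 'rV[rat]_d * 'rV[rat]_d :=
  odflt (0, 0) (unpickle n).
Definition rat_lo n : 'rV[R]_d := map_mx ratr (rat_corners n).1.
Definition rat_hi n : 'rV[R]_d := map_mx ratr (rat_corners n).2.

(** Boxes with rational corners are countably many, which is what lets an open
    set be handled by countable unions. *)
Lemma open_bigcup_rat_box U : open U ->
  U = \bigcup_(n in [set n | cbox (rat_lo n) (rat_hi n) `<=` U])
        obox (rat_lo n) (rat_hi n).
Proof.
move=> U_open; apply/seteqP; split => [x Ux|x [n /= nU xn]]; last first.
  exact/nU/obox_cbox.
have /nbhs_ballP[e /= e0 xeU] := open_nbhs_nbhs (conj U_open Ux).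
have lo i : exists q : rat, x ord0 i - e < ratr q < x ord0 i.
  have [|q] := @rat_in_itvoo R (x ord0 i - e) (x ord0 i); first by rewrite ltrBlDr ltrDl.
  by rewrite in_itv; exists q.
have hi i : exists q : rat, x ord0 i < ratr q < x ord0 i + e.
  have [|q] := @rat_in_itvoo R (x ord0 i) (x ord0 i + e); first by rewrite ltrDl.
  by rewrite in_itv; exists q.
have [l hl] := choice lo; have [h hh] := choice hi.
(* the corners are chosen within [e] of [x], on either side of it *)
exists (pickle (\row_i l i, \row_i h i)) => /=; last first.
  move=> i; rewrite /rat_lo /rat_hi /rat_corners pickleK/= !mxE.
  by have /andP[_ ->] := hl i; have /andP[-> _] := hh i.
rewrite /rat_lo /rat_hi /rat_corners pickleK/= => y hy; apply: xeU; split => // j i.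
rewrite ord1; have := hy i; rewrite !mxE /ball/= => /andP[h1 h2].
have /andP[h3 _] := hl i; have /andP[_ h4] := hh i.
rewrite distrC ltr_distl (lt_le_trans h3 h1)/=.
exact: le_lt_trans h2 h4.
Qed.

Lemma open_measurable_rV U : open U -> measurable U.
Proof.
move=> /open_bigcup_rat_box ->; apply: bigcup_measurable => n _.
exact: measurable_obox.
Qed.

(** The sigma-algebra of the coordinates is thus generated by a family of sets
    stable by intersection, as an induction on measurable sets requires. *)
Lemma measurable_g_obox : @measurable _ 'rV[R]_d =
  <<s [set A | exists a b, A = obox a b] >>.
Proof.
apply/seteqP; split; last first.
  apply: smallest_sub; first exact: sigma_algebra_measurable.
  by move=> _ [a [b ->]]; exact: measurable_obox.
set G := [set A | _]; have sG := smallest_sigma_algebra setT G.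
have openG U : open U -> <<s G >> U.
  move=> /open_bigcup_rat_box ->; rewrite bigcup_mkcond.
  apply: sigma_algebra_bigcup => n; case: ifPn => _; last exact: sigma_algebra0.
  by apply: sub_sigma_algebra; exists (rat_lo n), (rat_hi n).
apply: smallest_sub => //; rewrite -bigcup_seq => A [i _ [Y mY <-]] /=.
rewrite setTI.
suff : @measurable _ R `<=` [set Y | <<s G >> ((fun x : 'rV[R]_d => x ord0 i) @^-1` Y)].
  exact.
rewrite (measurable_realfun.RGenOpens.measurableE R : @measurable _ R = _).
apply: smallest_sub; last first.
  move=> _ [p [q ->]]; apply: openG.
  have /continuousP := @coord_continuous R 1 d ord0 i.
  by apply; exact: interval_open.
split => [|B h|F h] /=.
- by rewrite preimage_set0; exact: sigma_algebra0.
- by rewrite setTD -preimage_setC; exact: sigma_algebraC.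
- by rewrite preimage_bigcup; exact: sigma_algebra_bigcup.
Qed.

Lemma continuous_measurable_rV (f : 'rV[R]_d -> R) : continuous f ->
  measurable_fun setT f.
Proof.
move=> /continuousP cf; apply: (measurability _ (measurable_realfun.RGenOpens.measurableE R)) => //.
move=> _ [_ [x [y ->]] <-]; rewrite setTI; apply: open_measurable_rV.
by apply: cf; exact: interval_open.
Qed.

End boxes.

Section finite_on_bounded.
Context {R : realType}.

Lemma lebesgue_rV_cube n (M : R) :
  (lebesgue_rV n (cbox (const_mx (- M)) (const_mx M))%R < +oo)%E.
Proof.
elim: n => [|n IH] /=.
  rewrite diracE; case: (_ \in _) => /=; exact: ltry.
rewrite /pushforward (_ : _ @^-1` _ =
    cbox (const_mx (- M)) (const_mx M) `*` `[- M, M]%classic); last first.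
  apply/seteqP; split => -[x t] /=.
    move=> h; split => [i|]; last first.
      by have := h ord_max; rewrite /rV_rcons !mxE unlift_none /= in_itv.
    by have := h (lift ord_max i); rewrite /rV_rcons !mxE liftK.
  move=> [h]; rewrite in_itv /= => ht i; rewrite /rV_rcons !mxE.
  by case: unliftP => [j _|_] //=; have := h j; rewrite !mxE.
have /= -> := @product_measure1E _ _ _ _ R (lebesgue_rV n) (@lebesgue_measure R)
  _ _ (measurable_cbox (const_mx (- M)) (const_mx M)) (measurable_itv `[- M, M]).
apply: lte_mul_pinfty => //.
  by rewrite ge0_fin_numE.
by rewrite /= lebesgue_measure_itv /=; case: ifP => _; exact: ltry.
Qed.

Lemma bounded_set_sub_cbox n (A : set 'rV[R]_n) : bounded_set A ->
  exists M, A `<=` cbox (const_mx (- M)) (const_mx M).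
Proof.
move=> [M [_ hM]]; exists (M + 1) => x Ax i; rewrite !mxE -ler_norml.
apply: (@le_trans _ _ `|x|); last by apply: hM => //; rewrite ltrDl.
rewrite {2}/Num.norm/= mx_normrE.
by apply/bigmax_geP; right => /=; exists (ord0, i).
Qed.

Lemma lebesgue_rV_bounded n (A : set 'rV[R]_n) : measurable A -> bounded_set A ->
  (lebesgue_rV n A < +oo)%E.
Proof.
move=> mA /bounded_set_sub_cbox[M AM]; apply: le_lt_trans (lebesgue_rV_cube n M).
by apply: le_measure; rewrite ?inE//; exact: measurable_cbox.
Qed.
End finite_on_bounded.

(** * Smooth approximations of the indicator of a box *)

Section flat.
Context {R : realType}.
Implicit Types (p : {poly R}) (t : R).

(** For [p = 1] this is the classical function exp (-1/t), smooth at 0; the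
    polynomial factor makes the family stable by derivation. *)
Definition flat p t : R := if 0 < t then p.[t^-1] * expR (- t^-1) else 0.

Lemma flat_le0 p t : t <= 0 -> flat p t = 0.
Proof. by rewrite /flat leNgt; case: ifP. Qed.

Lemma expRN_fact_le (n : nat) (y : R) : 0 < y ->
  expR (- y) <= n.+1`!%:R / y ^+ n.+1.
Proof.
move=> y0; rewrite expRN -[leRHS]invrK lef_pV2 ?posrE ?expR_gt0//; last first.
  by rewrite invr_gt0 divr_gt0 ?exprn_gt0// ltr0n fact_gt0.
rewrite invf_div; apply: le_trans (expR_ge1Dxn n (ltW y0)).
by rewrite lerDr.
Qed.

(** The exponential beats every polynomial: exp (-y) is at most a constant times
    y^-(i+2), which bounds each monomial of [p] in y = 1/t by a multiple of
    t^2.  A quadratic bound at 0 gives a zero derivative there. *)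
Lemma flat_quadratic p : exists C : R, forall t, `|flat p t| <= C * t ^+ 2.
Proof.
exists (\sum_(i < size p) `|p`_i| * (i.+2)`!%:R) => t.
rewrite /flat; case: ifPn => [t0|_]; last first.
  by rewrite normr0 mulr_ge0 ?sqr_ge0 ?sumr_ge0// => i _; rewrite mulr_ge0.
rewrite normrM horner_coef (ger0_norm (expR_ge0 _)).
apply: (@le_trans _ _ (\sum_(i < size p) (`|p`_i| * t^-1 ^+ i) * expR (- t^-1))).
  rewrite -mulr_suml ler_pM ?expR_ge0//; apply: le_trans (ler_norm_sum _ _ _) _.
  by apply: ler_sum => i _; rewrite normrM normrX [`|t^-1|]ger0_norm// invr_ge0 ltW.
rewrite mulr_suml; apply: ler_sum => i _; rewrite -!mulrA ler_wpM2l//.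
have /(expRN_fact_le i.+1) h : 0 < t^-1 by rewrite invr_gt0.
apply: le_trans (ler_wpM2l _ h) _; first by rewrite exprn_ge0// invr_ge0 ltW.
rewrite exprVn !exprVn invrK mulrCA ler_wpM2l// -(addn2 i) exprD mulrA mulVf ?mul1r//.
by rewrite expf_neq0// gt_eqF.
Qed.

Lemma is_derive_flat p t : is_derive t 1 (flat p) (flat ('X ^+ 2 * (p - p^`())) t).
Proof.
have [t0|t0|->] := ltgtP t 0.
- rewrite flat_le0 ?ltW//.
  apply: (@near_eq_is_derive _ _ _ (cst 0)).
    near=> s; rewrite flat_le0//; near: s; apply: filterS (lt_nbhsl t0) => s; exact: ltW.
- have tn0 : t != 0 by rewrite gt_eqF.
  have dV := is_deriveV tn0 (is_derive_id t (1 : R)).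
  have dp : is_derive t 1 (horner p \o (fun s => s^-1)) (p^`().[t^-1] * (- t ^- 2 *: 1)).
    by apply: is_derive1_comp.
  have de : is_derive t 1 (expR \o (fun s => - s^-1)) (expR (- t^-1) * (- (- t ^- 2 *: 1))).
    by apply: is_derive1_comp.
  have D : is_derive t 1 (fun s => p.[s^-1] * expR (- s^-1)) (flat ('X ^+ 2 * (p - p^`())) t).
    apply: is_derive_eq (is_deriveM dp de) _.
    by rewrite /flat t0 /= !hornerE /GRing.scale/= expr2; field.
  apply: near_eq_is_derive D; near=> s; rewrite /flat ifT//; near: s; exact: lt_nbhsr.
- rewrite flat_le0//; have [C hC] := flat_quadratic p.
  have h : (fun h : R => h^-1 *: (flat p (h *: 1 + 0) - flat p 0)) @ 0^' --> (0 : R).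
    apply/cvgr0Pnorm_lt => e e0 /=; near=> s.
    rewrite addr0 [s *: 1]mulr1 (flat_le0 p (lexx 0)) subr0 normrM normfV.
    have s0 : s != 0 by near: s; exact: nbhs_dnbhs_neq.
    have sn : 0 < `|s| by rewrite normr_gt0.
    rewrite mulrC ltr_pdivrMr//; apply: le_lt_trans (hC s) _.
    rewrite -real_normK ?num_real// expr2 mulrA ltr_pM2r//.
    apply: (@le_lt_trans _ _ ((`|C| + 1) * `|s|)).
      by rewrite ler_wpM2r//; apply: le_trans (ler_norm _) _; rewrite lerDl.
    rewrite mulrC -ltr_pdivlMr ?ltr_wpDl//.
    near: s; apply: dnbhs0_lt; rewrite divr_gt0// ltr_wpDl//.
  by apply: DeriveDef; [apply/cvg_ex; exists 0; exact: h|exact: cvg_lim h].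
Unshelve. all: by end_near. Qed.

Lemma continuous_flat p : continuous (flat p).
Proof.
move=> t; apply: differentiable_continuous; apply/derivable1_diffP.
by have [] := is_derive_flat p t.
Qed.

Lemma flat1_01 t : 0 <= flat 1 t <= 1.
Proof.
rewrite /flat; case: ifPn => [t0|_]; last by rewrite lexx ler01.
by rewrite hornerC mul1r expR_ge0 expR_le1 lerNl oppr0 invr_ge0 ltW.
Qed.

Lemma flat1_cvg t : 0 < t -> flat 1 (n.+1%:R * t) @[n --> \oo] --> (1 : R).
Proof.
move=> t0; rewrite -[X in _ --> X](@expR0 R).
have -> : (fun n => flat 1 (n.+1%:R * t)) = (fun n => expR (- (n.+1%:R^-1 * t^-1))).
  by apply/funext => n; rewrite /flat mulr_gt0// hornerC mul1r invfM.
apply: continuous_cvg; first exact: continuous_expR.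
rewrite -oppr0 -[X in - X](mul0r t^-1); apply: cvgN; apply: cvgM; last exact: cvg_cst.
exact: cvg_harmonic.
Qed.
End flat.

Section Ck.
Context {R : realType} {d : nat}.
Implicit Types (f g : 'rV[R]_d -> R).

Lemma Ck_continuous k f : Ck k f -> continuous f.
Proof. by case: k => [|k] []. Qed.

Lemma CkW k f : Ck k.+1 f -> Ck k f.
Proof.
elim: k f => [|k IH] f [cf df]; split => // i.
by have [dfi /IH] := df i.
Qed.

Lemma Ck_cst k (c : R) : Ck k (cst c : 'rV[R]_d -> R).
Proof.
elim: k c => [|k IH] c; split => //; try exact: cst_continuous.
move=> i; split => [x|]; first exact: derivable_cst.
have -> : 'D_(ev i) (cst c) = cst 0 :> ('rV[R]_d -> R) by apply/funext => x; rewrite derive_cst.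
exact: IH.
Qed.

Lemma CkD k f g : Ck k f -> Ck k g -> Ck k (f \+ g).
Proof.
elim: k f g => [|k IH] f g [cf df] [cg dg]; 
  (split; first by move=> x; exact: (continuousD (cf x) (cg x))) => //.
move=> i; have [dfi Cf] := df i; have [dgi Cg] := dg i.
split => [x|]; first exact: derivableD.
have -> : 'D_(ev i) (f \+ g) = 'D_(ev i) f \+ 'D_(ev i) g.
  by apply/funext => x; rewrite deriveD.
exact: IH.
Qed.

Lemma CkM k f g : Ck k f -> Ck k g -> Ck k (f \* g).
Proof.
elim: k f g => [|k IH] f g Cf Cg.
  by split => // x; exact: (continuousM (@Ck_continuous _ _ Cf x) (@Ck_continuous _ _ Cg x)).
split; first by move=> x; exact: (continuousM (@Ck_continuous _ _ Cf x) (@Ck_continuous _ _ Cg x)).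
move=> i; have [dfi Cdf] := Cf.2 i; have [dgi Cdg] := Cg.2 i.
split => [x|]; first exact: derivableM.
have -> : 'D_(ev i) (f \* g) = (f \* 'D_(ev i) g) \+ (g \* 'D_(ev i) f).
  by apply/funext => x; rewrite deriveM.
by apply: CkD; apply: IH => //; exact: CkW.
Qed.

Lemma Ck_prod k (I : Type) (s : seq I) (F : I -> 'rV[R]_d -> R) :
  (forall i, Ck k (F i)) -> Ck k (fun x => \prod_(i <- s) F i x).
Proof.
move=> CF; elim: s => [|i s IH].
  by rewrite (_ : (fun _ => _) = cst 1); [exact: Ck_cst|apply/funext => x; rewrite big_nil].
rewrite (_ : (fun _ => _) = F i \* (fun x => \prod_(i <- s) F i x)); first exact: CkM.
by apply/funext => x; rewrite big_cons.
Qed.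

Lemma continuous_flat_coord (p : {poly R}) (s r : R) (j : 'I_d) :
  continuous (fun x : 'rV[R]_d => flat p (s * x ord0 j + r)).
Proof.
move=> x; apply: (@continuous_comp _ _ _ (fun x : 'rV[R]_d => s * x ord0 j + r)).
  apply: (continuousD (f := fun x : 'rV[R]_d => s * x ord0 j)); last exact: cst_continuous.
  apply: (continuousM (s := fun=> s)); first exact: cst_continuous.
  exact: coord_continuous.
exact: continuous_flat.
Qed.

(** A partial derivative is a constant times a function of the same form, with
    another polynomial. *)
Lemma Ck_flat k (p : {poly R}) (s r : R) (j : 'I_d) :
  Ck k (fun x : 'rV[R]_d => flat p (s * x ord0 j + r)).
Proof.
elim: k p => [|k IH] p.
  by split => //; exact: continuous_flat_coord.
split.
  exact: continuous_flat_coord.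
move=> i; pose q := 'X ^+ 2 * (p - p^`()).
have D x : is_derive x (ev i) (fun x : 'rV[R]_d => flat p (s * x ord0 j + r))
    ((s * (i == j)%:R) * flat q (s * x ord0 j + r)).
  pose l (h : R) := s * ((i == j)%:R * h + x ord0 j) + r.
  have fl : (fun h : R => flat p (s * (h *: ev i + x) ord0 j + r)) = flat p \o l.
    apply/funext => h; rewrite /l/= !mxE eqxx/= eq_sym.
    do 2 congr (_ _); congr (_ * (_ + _) + _).
    by rewrite mulrC.
  have dl : is_derive (0 : R) 1 l (s * (i == j)%:R).
    apply: is_derive_eq; rewrite ?/GRing.scale/= ?mulr1 ?addr0 ?mulr0 ?add0r//.
  have dc : is_derive (0 : R) 1 (flat p \o l) (flat q (l 0) * (s * (i == j)%:R)).
    by apply: is_derive1_comp; exact: is_derive_flat.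
  have l0 : l 0 = s * x ord0 j + r by rewrite /l mulr0 add0r.
  rewrite -fl l0 in dc.
  case: dc => dc1 dc2; apply: DeriveDef; first exact/derivable1P.
  rewrite mulrC -dc2 /derive; set g1 := fun h => h^-1 *: _; set g2 := fun h => h^-1 *: _.
  suff -> : g1 = g2 by [].
  by apply/funext => h; rewrite /g1 /g2 /= addr0 scale0r add0r [_%:A]mulr1.
split => [x|]; first by have [] := D x.
have -> : 'D_(ev i) (fun x : 'rV[R]_d => flat p (s * x ord0 j + r)) =
    cst (s * (i == j)%:R) \* (fun x => flat q (s * x ord0 j + r)).
  by apply/funext => x; have [_ ->] := D x.
by apply: CkM; [exact: Ck_cst|exact: IH].
Qed.

(** As [n] grows, each factor increases to the indicator of a half-line. *)
Definition box_bump (a b : 'rV[R]_d) (n : nat) (x : 'rV[R]_d) : R :=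
  \prod_(i < d) (flat 1 (n.+1%:R * (x ord0 i - a ord0 i)) *
                 flat 1 (n.+1%:R * (b ord0 i - x ord0 i))).

Lemma box_bump_notin a b n x : ~ obox a b x -> box_bump a b n x = 0.
Proof.
move=> /existsNP[i /negP]; rewrite negb_and -!leNgt => h.
rewrite /box_bump (bigD1 i)//=; case/orP: h => h.
  by rewrite (@flat_le0 _ _ (_ * (x _ _ - _))) ?mul0r// mulr_ge0_le0// subr_le0.
by rewrite (@flat_le0 _ _ (_ * (_ - x _ _))) ?mulr0 ?mul0r// mulr_ge0_le0// subr_le0.
Qed.

Lemma box_bump_01 a b n x : 0 <= box_bump a b n x <= 1.
Proof.
apply/andP; split.
  by apply: prodr_ge0 => i _; rewrite mulr_ge0//;
  have /andP[] := flat1_01 (n.+1%:R * (x ord0 i - a ord0 i));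
  have /andP[] := flat1_01 (n.+1%:R * (b ord0 i - x ord0 i)).
apply: prodr_ile1 => i _.
have /andP[h1 h2] := flat1_01 (n.+1%:R * (x ord0 i - a ord0 i)).
have /andP[h3 h4] := flat1_01 (n.+1%:R * (b ord0 i - x ord0 i)).
by rewrite mulr_ge0//= mulr_ile1.
Qed.

Lemma box_bump_cvg a b x : box_bump a b n x @[n --> \oo] --> (\1_(obox a b) x : R).
Proof.
rewrite indicE; case: (boolP (x \in obox a b)); rewrite ?inE ?notin_setE => h; last first.
  rewrite (_ : (fun _ => _) = cst 0); first exact: cvg_cst.
  by apply/funext => n; exact: box_bump_notin.
rewrite /= -(@big1 _ 1 *%R _ (index_enum 'I_d) xpredT (fun=> 1))//.
apply: cvg_big => [|i _].
  move=> [u v]; exact: mul_continuous.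
have /andP[h1 h2] := h i.
rewrite -[X in _ --> X]mulr1; apply: cvgM; apply: flat1_cvg; by rewrite subr_gt0.
Qed.

Lemma test_function_box_bump (U : set 'rV[R]_d) a b n : cbox a b `<=` U ->
  test_function U (box_bump a b n).
Proof.
move=> abU.
have cl : closure [set x | box_bump a b n x != 0] `<=` cbox a b.
  rewrite closureE; apply: smallest_sub => /=.
    by apply: compact_closed; [exact: norm_hausdorff|exact: compact_cbox].
  move=> x /= h; apply: obox_cbox; apply: contrapT => hx; move: h.
  by rewrite box_bump_notin// eqxx.
split; last exact: subset_trans abU.
  move=> k; apply: Ck_prod => i; apply: CkM.
    rewrite (_ : (fun _ => _) = (fun x : 'rV[R]_d =>
        flat 1 (n.+1%:R * x ord0 i - n.+1%:R * a ord0 i))).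
      exact: Ck_flat.
    by apply/funext => x; rewrite mulrBr.
  rewrite (_ : (fun _ => _) = (fun x : 'rV[R]_d =>
      flat 1 (- n.+1%:R * x ord0 i + n.+1%:R * b ord0 i))).
    exact: Ck_flat.
  by apply/funext => x; rewrite mulrBr addrC mulNr.
apply: subclosed_compact (@compact_cbox _ _ a b) cl.
exact: closed_closure.
Qed.
End Ck.

(** * A function orthogonal to all test functions vanishes *)

Section fundamental_lemma.
Context {R : realType} {d : nat}.
Local Notation mu := (lebesgue_rV d : {measure set 'rV[R]_d -> \bar R}).
Variables (U : set 'rV[R]_d) (q : 'rV[R]_d -> R).
Hypothesis U_open : open U.
Hypothesis iq : mu.-integrable U (EFin \o q).
Hypothesis q_test : forall f, test_function U f ->
  \int[mu]_(x in U) (q x * f x) = 0.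

Let mU : measurable U := open_measurable_rV U_open.
Let mq : measurable_fun U q.
Proof. by apply/measurable_EFinP; exact: measurable_int iq. Qed.

(* [q] times the indicator of the box is the limit of [q] times test functions,
   dominated by the modulus of [q]. *)
Let integral_obox a b : cbox a b `<=` U ->
  (\int[mu]_(x in obox a b) (q x)%:E = 0)%E.
Proof.
move=> abU.
have obU : obox a b `<=` U by apply: subset_trans abU; exact: obox_cbox.
have mB n : measurable_fun U (box_bump a b n).
  apply: measurable_funTS; apply: continuous_measurable_rV.
  have [+ _ _] := test_function_box_bump n abU.
  by move=> /(_ 0%N) /Ck_continuous.
have ib n : mu.-integrable U (fun x => (q x * box_bump a b n x)%:E).
  apply: le_integrable iq => //.
    by apply/measurable_EFinP; exact: measurable_funM.
  move=> x Ux /=; rewrite lee_fin normrM ler_piMr// ger0_norm.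
    by have /andP[] := box_bump_01 a b n x.
  by have /andP[] := box_bump_01 a b n x.
have i0 n : (\int[mu]_(x in U) (q x * box_bump a b n x)%:E = 0)%E.
  rewrite -[LHS]fineK; last exact: integrable_fin_num.
  by congr EFin; apply: q_test; exact: test_function_box_bump.
have mob := measurable_obox a b.
transitivity (\int[mu]_(x in U) (q x * \1_(obox a b) x)%:E)%E.
  rewrite -[in LHS](setIidr obU) integral_mkcondr.
  apply: eq_integral => x _; rewrite patchE indicE.
  by case: ifP => _; rewrite ?mulr1 ?mulr0.
have mlim : measurable_fun U (fun x => (q x * \1_(obox a b) x)%:E).
  by apply/measurable_EFinP; apply: measurable_funM => //; exact: measurable_indic.
have blim : {ae mu, forall x, U x -> (q x * box_bump a b n x)%:E @[n --> \oo] -->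
    (q x * \1_(obox a b) x)%:E}.
  apply: aeW => x _; apply: cvg_EFin; first exact: nearW.
  by apply: cvgM; [exact: cvg_cst|exact: box_bump_cvg].
have dom : {ae mu, forall x n, U x ->
    (`|(q x * box_bump a b n x)%:E| <= `|(q x)%:E|)%E}.
  apply: aeW => x n _ /=; rewrite lee_fin normrM ler_piMr// ger0_norm;
    by have /andP[] := box_bump_01 a b n x.
have [_ _ /cvg_lim h] := @dominated_convergence _ _ _ mu U mU
  (fun n x => (q x * box_bump a b n x)%:E) (fun x => (q x * \1_(obox a b) x)%:E)
  (fun x => `|(q x)%:E|)%E
  (fun n => measurable_int _ (ib n)) mlim blim (integrable_abse iq) dom.
rewrite -h// (_ : (fun _ => _) = cst 0%E); first exact: lim_cst.
by apply/funext => n; exact: i0.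
Qed.

(* The sets [A] over which the integral vanishes are stable by complement and by
   countable disjoint unions, and contain the boxes. *)
Let integral_measurable a b A : cbox a b `<=` U -> measurable A ->
  (\int[mu]_(x in A `&` obox a b) (q x)%:E = 0)%E.
Proof.
move=> abU mA; have mob := measurable_obox a b.
have obU : obox a b `<=` U by apply: subset_trans abU; exact: obox_cbox.
have iob : mu.-integrable (obox a b) (EFin \o q) by exact: integrableS iq.
move: mA; rewrite measurable_g_obox; move: A.
apply: dynkin_induction.
- exact: measurable_g_obox.
- move=> _ _ [l [h ->]] [l' [h' ->]]; rewrite oboxI.
  by eexists; eexists; reflexivity.
- by rewrite setTI integral_obox.
- move=> _ [l [h ->]]; rewrite oboxI; apply: integral_obox.
  apply: subset_trans abU => x + i => /(_ i).
  by rewrite !mxE ge_max le_min => /andP[/andP[_ ->] /andP[_ ->]].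
- move=> A mA iA.
  have mAc : measurable (~` A) by exact: measurableC.
  have := integral_obox abU; rewrite -[in X in X -> _](setTI (obox a b)) -(setUv A) setIUl.
  rewrite integral_setU_EFin ?iA ?add0e//; try exact: measurableI.
    by rewrite -setIUl setUv setTI; apply: measurable_funS mq.
  apply/disj_set2P; rewrite -setIIl; apply/seteqP; split => // x [[]]//.
- move=> F mF tF iF; rewrite setI_bigcupl integral_bigcup.
  + by apply: eseries0 => n _ _; exact: iF.
  + exact: trivIset_setIr.
  + by move=> k; exact: measurableI.
  + apply: integrableS iob => //; first by apply: bigcupT_measurable => k; exact: measurableI.
    by move=> x [k _ []].
Qed.

(** On each rational box inside [U] all the integrals of [q] vanish, so [q] does;
    countably many such boxes cover [U]. *)
Lemma du_bois_reymond : {ae mu, forall x, U x -> q x = 0}.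
Proof.
pose B n := obox (@rat_lo R d n) (rat_hi n).
pose good n := cbox (@rat_lo R d n) (rat_hi n) `<=` U.
have aeB n : good n -> {ae mu, forall x, B n x -> q x = 0}.
  move=> gn.
  have mB : measurable (B n) by exact: measurable_obox.
  have BU : B n `<=` U by apply: subset_trans gn; exact: obox_cbox.
  have iB : mu.-integrable (B n) (EFin \o q) by exact: integrableS iq.
  have : ae_eq mu (B n) (EFin \o q) (cst 0%E).
    apply: integral_ae_eq => // E EB mE.
    by rewrite integral0 -(setIidl EB); exact: integral_measurable.
  by apply: filterS => x h Bx; have [] := h Bx.
have /negligibleS : mu.-negligible (\bigcup_n
    (if `[< good n >] then ~` [set x | B n x -> q x = 0] else set0)).
  apply: negligible_bigcup => n; case: asboolP => gn; last exact: negligible_set0.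
  exact: aeB.
apply => x /= /not_implyP[Ux qx].
move: (Ux); rewrite (open_bigcup_rat_box U_open) => -[n /= gn Bx].
by exists n => //; rewrite asboolT// => /(_ Bx).
Qed.
End fundamental_lemma.

(** * Orthogonal projection in a semi-inner product space *)

(** Letting [n] grow, then [t] tend to 0 from either side, leaves no room for
    [x].  This replaces the Cauchy-Schwarz inequality when orthogonality is
    passed to a limit. *)
Lemma quadratic_bound_eq0 (R : realType) (x N C : R) : 0 <= N ->
  (forall t n, t * x *+ 2 <= t ^+ 2 * N + C * (4^-1) ^+ n) -> x = 0.
Proof.
move=> N0 h.
have lim t : t * x *+ 2 <= t ^+ 2 * N.
  have c : t ^+ 2 * N + C * (4^-1) ^+ n @[n --> \oo] --> t ^+ 2 * N + C * 0.
    apply: cvgD; first exact: cvg_cst.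
    apply: cvgM; first exact: cvg_cst.
    by apply: cvg_expr; rewrite ger0_norm; lra.
  rewrite mulr0 addr0 in c; rewrite -(cvg_lim _ c)//.
  by apply: limr_ge; [apply/cvg_ex; eexists; exact: c|exact: nearW].
have N1 : 0 < N + 1 by lra.
(* the best [t] is [x / N]; [N + 1] avoids the division by zero *)
have := lim (x / (N + 1)); rewrite expr_div_n => hx.
have h2 : x ^+ 2 * (N + 1) *+ 2 <= x ^+ 2 * N.
  move: hx; rewrite -(ler_pM2r (exprn_gt0 2 N1)).
  have -> : x / (N + 1) * x *+ 2 * (N + 1) ^+ 2 = x ^+ 2 * (N + 1) *+ 2.
    by field; rewrite gt_eqF.
  by have -> : x ^+ 2 / (N + 1) ^+ 2 * N * (N + 1) ^+ 2 = x ^+ 2 * N by field; rewrite gt_eqF.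
have x2 : x ^+ 2 <= 0.
  have : 0 <= x ^+ 2 * N by rewrite mulr_ge0// sqr_ge0.
  lra.
by apply/eqP; rewrite -sqrf_eq0 eq_le x2 sqr_ge0.
Qed.

(** The form [b] is only a semi-inner product, bilinear on [S] only, because
    fields are not quotiented by equality almost everywhere and the integrals
    are meaningful for square-integrable fields only.  The completeness of [K]
    is asked for fast Cauchy sequences, whose limit is approached at a geometric
    rate; this avoids the extraction of subsequences. *)
Section projection.
Context {R : realType} {E : lmodType R[i]}.
Variables (S K : set E) (b : E -> E -> R).
Hypothesis S_closed : forall (t : R) x y, S x -> S y -> S (x + t%:C *: y).
Hypothesis K_closed : forall (t : R) x y, K x -> K y -> K (x + t%:C *: y).
Hypothesis K0 : K 0.
Hypothesis KS : K `<=` S.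
Hypothesis b_linear : forall (t : R) x y z, S x -> S y -> S z ->
  b (x + t%:C *: y) z = b x z + t * b y z.
Hypothesis b_sym : forall x y, S x -> S y -> b x y = b y x.
Hypothesis b_ge0 : forall x, S x -> 0 <= b x x.
Hypothesis K_complete : forall k : nat -> E, (forall n, K (k n)) ->
  (forall n m, (n <= m)%N -> b (k m - k n) (k m - k n) <= 4 * (4^-1) ^+ n) ->
  exists k', K k' /\
    exists C : R, forall n, b (k n - k') (k n - k') <= C * (4^-1) ^+ n.

Let b_square (t : R) x y : S x -> S y ->
  b (x + t%:C *: y) (x + t%:C *: y) = b x x + t * b x y *+ 2 + t ^+ 2 * b y y.
Proof.
move=> Sx Sy; have Sz := S_closed t Sx Sy.
rewrite b_linear// ![b _ (x + _)]b_sym// !b_linear// (b_sym Sy Sx).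
ring.
Qed.

Let subE (x y : E) : x - y = x + (-1 : R)%:C *: y.
Proof. by rewrite rmorphN1 scaleN1r. Qed.

Let S_sub x y : S x -> S y -> S (x - y).
Proof. by rewrite subE; exact: S_closed. Qed.

(** The square of [x - t y] is nonnegative. *)
Lemma polarization_le (t : R) x y : S x -> S y ->
  t * b x y *+ 2 <= b x x + t ^+ 2 * b y y.
Proof.
move=> Sx Sy; have := b_ge0 (S_closed (- t) Sx Sy); rewrite b_square// sqrrN mulNr.
lra.
Qed.

(** A minimizing sequence for the distance of [v] to [K] is Cauchy by the
    parallelogram identity.  The minimality is only used along the sequence: it
    bounds the product of [v - k n] with [w], and the product of [k n - k'] with
    [w] is bounded by [polarization_le], so the distance from [v] to the limit
    never has to be computed. *)
Lemma orthogonal_projection v : S v ->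
  exists2 k, K k & forall k', K k' -> b (v - k) k' = 0.
Proof.
move=> Sv.
pose D := [set b (v - k) (v - k) | k in K].
have lbD : lbound D 0 by move=> _ [k Kk <-]; exact/b_ge0/S_sub/KS.
have D_inf : has_inf D by split; [exists (b (v - 0) (v - 0)), 0|exists 0].
pose delta := inf D.
have deltaP k : K k -> delta <= b (v - k) (v - k).
  by move=> Kk; apply: ge_inf; [exists 0|exists k].
have e_gt0 n : 0 < (4^-1 : R) ^+ n by rewrite exprn_gt0.
have /choice[k kP] n : exists k, K k /\ b (v - k) (v - k) < delta + (4^-1) ^+ n.
  by have [_ [k Kk <-] h] := inf_adherent (e_gt0 n) D_inf; exists k.
have Kk n : K (k n) := (kP n).1.
have Su n : S (v - k n) by exact/S_sub/KS.
(* midpoint of [k n] and [k m], for the parallelogram identity *)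
have halfE n m : v - k n + (1 : R)%:C *: (v - k m) =
    (2 : R)%:C *: (v - (0 + (2^-1 : R)%:C *: (k n + (1 : R)%:C *: k m))).
  rewrite add0r scale1r !scale1r scalerBr scalerA -rmorphM/= divff// scale1r.
  by rewrite -[2]/(1 + 1) rmorphD/= scalerDl scale1r opprD addrACA.
have near n m : b (k m - k n) (k m - k n) <= ((4^-1) ^+ n + (4^-1) ^+ m) *+ 2.
  have -> : k m - k n = (v - k n) + (-1 : R)%:C *: (v - k m).
    by rewrite -subE opprB [RHS]addrC addrA subrK.
  have Kh : K (0 + (2^-1 : R)%:C *: (k n + (1 : R)%:C *: k m)).
    by apply: K_closed => //; exact: K_closed.
  have := deltaP _ Kh.
  have := b_square 1 (Su n) (Su m); rewrite halfE.
  have Sh := S_sub Sv (KS Kh).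
  have S0 := KS K0.
  rewrite -[_ *: (v - _)]add0r b_square//.
  rewrite b_square//.
  have b0 z : S z -> b 0 z = 0.
    by move=> Sz; have := b_linear 1 (KS K0) (KS K0) Sz; rewrite scaler0 addr0 mul1r => h; lra.
  rewrite !b0//.
  have := (kP n).2; have := (kP m).2.
  lra.
have rapid n m : (n <= m)%N -> b (k m - k n) (k m - k n) <= 4 * (4^-1) ^+ n.
  move=> nm; apply: (le_trans (near n m)).
  have : (4^-1 : R) ^+ m <= (4^-1) ^+ n by apply: ler_wiXn2l => //; lra.
  lra.
have [k' [Kk' [C hC]]] := K_complete Kk rapid.
exists k' => // w Kw.
have Sw := KS Kw; have Sk n : S (k n - k') by exact/S_sub/KS/Kk'/KS.
have Svk : S (v - k') by exact/S_sub/KS.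
have uE n : v - k' = (v - k n) + (1 : R)%:C *: (k n - k').
  by rewrite scale1r addrA subrK.
apply: (quadratic_bound_eq0 (N := b w w *+ 2) (C := 1 + C)) => [|t n].
  by rewrite mulrn_wge0// b_ge0.
rewrite (uE n) b_linear//.
have h1 := polarization_le t (Sk n) Sw.
have : delta <= b (v - k n + (- t)%:C *: w) (v - k n + (- t)%:C *: w).
  have -> : v - k n + (- t)%:C *: w = v - (k n + t%:C *: w).
    by rewrite rmorphN scaleNr opprD addrA.
  by apply/deltaP/K_closed.
rewrite b_square// sqrrN mulNr.
have := (kP n).2; have := hC n; lra.
Qed.
End projection.

(** * Square-integrable real functions *)

Section square_integrable.
Context d (T : measurableType d) (R : realType).
Variables (mu : {measure set T -> \bar R}) (U : set T).
Hypothesis mU : measurable U.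
Implicit Types f g w : T -> R.

Definition sq_integrable f :=
  measurable_fun U f /\ (\int[mu]_(x in U) (f x ^+ 2)%:E < +oo)%E.

Definition bounded_on w := measurable_fun U w /\
  exists M : R, forall x, U x -> `|w x| <= M.

Lemma measurable_sqr f : measurable_fun U f ->
  measurable_fun U (fun x => (f x ^+ 2)%:E).
Proof. by move=> mf; apply/measurable_EFinP; exact: measurable_funX. Qed.

Lemma sq_integrable_sqr f : sq_integrable f -> mu.-integrable U (fun x => (f x ^+ 2)%:E).
Proof.
move=> [mf fi]; apply/integrableP; split; first exact: measurable_sqr.
by under eq_integral do rewrite /= ger0_norm ?sqr_ge0//.
Qed.

Lemma sq_integrableD f g : sq_integrable f -> sq_integrable g ->
  sq_integrable (f \+ g).
Proof.
move=> Lf Lg; have mfg : measurable_fun U (f \+ g).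
  by apply: measurable_funD; [exact: Lf.1|exact: Lg.1].
split => //.
have i2 : mu.-integrable U (fun x => (2 * (f x ^+ 2 + g x ^+ 2))%:E).
  have := integrableZl mU 2 (integrableD mU (sq_integrable_sqr Lf) (sq_integrable_sqr Lg)).
  by apply: eq_integrable => // x _; rewrite /= EFinM EFinD.
have : mu.-integrable U (fun x => ((f x + g x) ^+ 2)%:E).
  apply: le_integrable i2 => //; first exact: measurable_sqr.
  move=> x _ /=; rewrite lee_fin !ger0_norm ?sqr_ge0// ?mulr_ge0 ?addr_ge0 ?sqr_ge0//.
  have := sqr_ge0 (f x - g x); lra.
move=> /integrableP[_]; under eq_integral do rewrite /= ger0_norm ?sqr_ge0//.
by [].
Qed.

Lemma sq_integrable_weight w f : bounded_on w -> sq_integrable f -> sq_integrable (w \* f).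
Proof.
move=> [mw [M wM]] Lf; have mwf : measurable_fun U (w \* f).
  by apply: measurable_funM => //; exact: Lf.1.
split => //.
have i2 : mu.-integrable U (fun x => (M ^+ 2 * f x ^+ 2)%:E).
  have := integrableZl mU (M ^+ 2) (sq_integrable_sqr Lf).
  by apply: eq_integrable => // x _; rewrite /= EFinM.
have : mu.-integrable U (fun x => ((w x * f x) ^+ 2)%:E).
  apply: le_integrable i2 => //; first exact: measurable_sqr.
  move=> x Ux /=; rewrite lee_fin !ger0_norm ?sqr_ge0//; last by rewrite mulr_ge0 ?sqr_ge0.
  rewrite exprMn ler_wpM2r ?sqr_ge0//.
  by rewrite -(real_normK (num_real (w x))) lerXn2r// ?nnegrE// ?wM//; exact: le_trans (wM _ Ux).
move=> /integrableP[_]; under eq_integral do rewrite /= ger0_norm ?sqr_ge0//.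
by [].
Qed.

Lemma bounded_on_cst (c : R) : bounded_on (cst c).
Proof. by split; [exact: measurable_cst|exists `|c|]. Qed.

Lemma sq_integrable_integrableM f g : sq_integrable f -> sq_integrable g ->
  mu.-integrable U (EFin \o (f \* g)).
Proof.
move=> Lf Lg.
have := integrableD mU (sq_integrable_sqr Lf) (sq_integrable_sqr Lg).
apply: le_integrable => //.
  by apply/measurable_EFinP; apply: measurable_funM; [exact: Lf.1|exact: Lg.1].
move=> x _ /=; rewrite lee_fin [leRHS]ger0_norm ?addr_ge0 ?sqr_ge0// ler_norml.
have := sqr_ge0 (f x + g x); have := sqr_ge0 (f x - g x).
have := sqr_ge0 (f x); have := sqr_ge0 (g x).
by move=> *; apply/andP; split; lra.
Qed.

Hypothesis muU : (mu U < +oo)%E.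

Lemma sq_integrable_bounded w : bounded_on w -> sq_integrable w.
Proof.
move=> bw; suff : sq_integrable (w \* cst 1).
  by rewrite /sq_integrable; under [w \* _]funext do rewrite /= mulr1.
apply: sq_integrable_weight => //; split; first exact: measurable_cst.
by under eq_integral do rewrite expr1n; rewrite integral_cst// mul1e.
Qed.

(** Let [delta n] be the successive differences of the sequence.  By the
    inequality of the means, the modulus of [delta n] is at most
    [2 ^ n * delta n ^ 2 + 2 ^- n], whose series has a finite integral; hence the
    sequence converges almost everywhere, and Fatou's lemma turns the Cauchy
    estimates into estimates of the distance to the limit. *)
Section complete.
Variables (f : nat -> T -> R) (C : R).
Hypothesis Lf : forall n, sq_integrable (f n).
Hypothesis f_cauchy : forall n m, (n <= m)%N ->
  (\int[mu]_(x in U) ((f m x - f n x) ^+ 2)%:E <= (C * (4^-1) ^+ n)%:E)%E.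

Let delta n x := f n.+1 x - f n x.
Let dom n x : R := 2 ^+ n * delta n x ^+ 2 + (2^-1) ^+ n.

Let mdelta n : measurable_fun U (delta n).
Proof. by apply: measurable_funB; [exact: (Lf n.+1).1|exact: (Lf n).1]. Qed.

Let mdom n : measurable_fun U (EFin \o dom n).
Proof.
apply/measurable_EFinP; apply: measurable_funD; last exact: measurable_cst.
by apply: measurable_funM; [exact: measurable_cst|exact: measurable_funX].
Qed.

Let dom_ge0 n x : 0 <= dom n x.
Proof.
by apply: addr_ge0; [apply: mulr_ge0; [exact: exprn_ge0|exact: sqr_ge0]|exact: exprn_ge0].
Qed.

Let delta_dom n x : `|delta n x| <= dom n x.
Proof.
rewrite /dom exprVn; set D := delta n x.
have p0 : 0 < 2 ^+ n :> R by rewrite exprn_gt0.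
set p := 2 ^+ n in p0 *.
have h : `|D| <= p^-1 * (p ^+ 2 * D ^+ 2 + 1).
  rewrite mulrC ler_pdivlMr// -(real_normK (num_real D)).
  have := sqr_ge0 (p * `|D| - 1); have : 0 <= p * `|D| by rewrite mulr_ge0// ltW.
  by rewrite sqrrB exprMn; lra.
suff <- : p^-1 * (p ^+ 2 * D ^+ 2 + 1) = p * D ^+ 2 + p^-1 by [].
by field; rewrite gt_eqF.
Qed.

Let integral_dom : (\int[mu]_(x in U) (\sum_(n <oo) (dom n x)%:E) < +oo)%E.
Proof.
have muE : mu U = (fine (mu U))%:E by rewrite fineK// ge0_fin_numE.
rewrite integral_nneseries//; last by move=> n x _; rewrite lee_fin.
apply: (@le_lt_trans _ _ (\sum_(n <oo) ((C + fine (mu U)) * (2^-1) ^+ n)%:E)%E).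
  apply: lee_nneseries => n _; first by move=> _; apply: integral_ge0 => x _; rewrite lee_fin.
  have -> : (\int[mu]_(x in U) (dom n x)%:E =
      (2 ^+ n)%:E * (\int[mu]_(x in U) (delta n x ^+ 2)%:E) + ((2^-1) ^+ n)%:E * mu U)%E.
    under eq_integral do rewrite EFinD EFinM.
    rewrite ge0_integralD//=.
    - rewrite ge0_integralZl_EFin// ?integral_cst//; last exact: measurable_sqr.
      by move=> x _; rewrite lee_fin sqr_ge0.
    - by move=> x _; rewrite lee_fin; apply: mulr_ge0; [exact: exprn_ge0|exact: sqr_ge0].
    - apply/measurable_EFinP.
      by apply: measurable_funM; [exact: measurable_cst|exact: measurable_funX].
  rewrite muE -EFinM mulrDl EFinD leeD//; last by rewrite mulrC.
  have := f_cauchy (leqnSn n) => h.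
  apply: (@le_trans _ _ ((2 ^+ n)%:E * (C * (4^-1) ^+ n)%:E)%E).
    by rewrite lee_pmul2l// lte_fin exprn_gt0.
  rewrite -EFinM lee_fin mulrCA -exprMn.
  by have -> : 2 * 4^-1 = 2^-1 :> R by field.
have cg : cvgn (series (geometric (C + fine (mu U)) (2^-1 : R))).
  by apply: is_cvg_geometric_series; rewrite ger0_norm//; lra.
rewrite (_ : (fun n : nat => _) =
    EFin \o series (geometric (C + fine (mu U)) (2^-1 : R))); last first.
  by apply/funext => n; rewrite sumEFin.
by rewrite EFin_lim// ltry.
Qed.

Let cvg_f x : (\sum_(n <oo) (dom n x)%:E < +oo)%E -> cvgn (f ^~ x).
Proof.
move=> S_fin.
have cdom : cvgn (series (dom ^~ x)).
  apply: nondecreasing_is_cvgn; first exact: nondecreasing_series.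
  exists (fine (\sum_(n <oo) (dom n x)%:E)%E) => _ [n _ <-].
  rewrite -lee_fin fineK; last first.
    by rewrite ge0_fin_numE// nneseries_ge0// => k _ _; rewrite lee_fin.
  rewrite /series/= -sumEFin; apply: nneseries_lim_ge => k _ _.
  by rewrite lee_fin.
have cd : cvgn (series (telescope (f ^~ x))).
  by apply: normed_cvg; apply: series_le_cvg cdom => n //=; exact: delta_dom.
rewrite (_ : f ^~ x = (fun n => f 0%N x + series (telescope (f ^~ x)) n)).
  by apply: is_cvgD => //; exact: is_cvg_cst.
by apply/funext => n; rewrite -eq_sum_telescope.
Qed.

Lemma sq_integrable_complete : exists g, sq_integrable g /\
  forall n, (\int[mu]_(x in U) ((f n x - g x) ^+ 2)%:E <= (C * (4^-1) ^+ n)%:E)%E.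
Proof.
pose S x := (\sum_(n <oo) (dom n x)%:E)%E.
have S_ge0 x : (0 <= S x)%E by apply: nneseries_ge0 => n _ _; rewrite lee_fin.
have iS : mu.-integrable U S.
  apply/integrableP; split.
    exact: (@ge0_emeasurable_sum _ _ _ U (fun n x => (dom n x)%:E) xpredT
      (fun n x _ _ => dom_ge0 n x) (fun n _ => mdom n)).
  by under eq_integral do rewrite gee0_abs//; exact: integral_dom.
(* outside the null set [N] the sequence converges; inside, the limit is set to 0 *)
have [N [mN N0 sN]] := integrable_ae mU iS.
pose A := U `\` N.
have mA : measurable A by exact: measurableD.
have AU : A `<=` U by move=> x [].
have cvgA x : A x -> f n x @[n --> \oo] --> limn (f ^~ x).
  move=> [Ux Nx]; apply: cvg_f; rewrite -/(S x) -ge0_fin_numE//.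
  by apply: contrapT => h; apply: Nx; apply: sN => /= /(_ Ux).
pose g x := limn (f ^~ x) * \1_A x.
have mg : measurable_fun U g.
  apply: (@measurable_fun_cvg _ _ _ U (fun n x => f n x * \1_A x)) => [n|x Ux].
    by apply: measurable_funM; [exact: (Lf n).1|exact: measurable_indic].
  rewrite /g indicE; case: (boolP (x \in A)); rewrite ?inE => xA /=.
    by apply: cvgM; [exact: cvgA|exact: cvg_cst].
  by rewrite mulr0; under eq_fun do rewrite mulr0; exact: cvg_cst.
have mfg n : measurable_fun U (fun x => f n x - g x).
  by apply: measurable_funB => //; exact: (Lf n).1.
have mff n m : measurable_fun U (fun x => f m x - f n x).
  by apply: measurable_funB => //; [exact: (Lf m).1|exact: (Lf n).1].
have fg n : (\int[mu]_(x in U) ((f n x - g x) ^+ 2)%:E <= (C * (4^-1) ^+ n)%:E)%E.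
  have nneg x : U x -> (0 <= ((f n x - g x) ^+ 2)%:E)%E by move=> _; rewrite lee_fin sqr_ge0.
  rewrite (ge0_negligible_integral mN mU (measurable_sqr (mfg n)) nneg N0).
  rewrite -/A.
  have -> : (\int[mu]_(x in A) ((f n x - g x) ^+ 2)%:E =
      \int[mu]_(x in A) limn_einf (fun m => ((f m x - f n x) ^+ 2)%:E))%E.
    apply: eq_integral => x /[!inE] Ax.
    have c : ((f m x - f n x) ^+ 2)%:E @[m --> \oo] --> ((f n x - g x) ^+ 2)%:E.
      apply: cvg_EFin; first exact: nearW.
      rewrite /= /comp/= -[X in _ --> X]sqrrN opprB.
      rewrite /g indicE mem_set// mulr1 expr2; under eq_fun do rewrite expr2.
      by apply: cvgM; apply: cvgB; try exact: cvg_cst; exact: cvgA.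
    by rewrite is_cvg_limn_einfE; [exact/esym/cvg_lim|apply/cvg_ex; eexists; exact: c].
  apply: (@le_trans _ _ (limn_einf (fun m => \int[mu]_(x in A) ((f m x - f n x) ^+ 2)%:E)%E)).
    apply: (@fatou _ _ _ mu A mA (fun m x => ((f m x - f n x) ^+ 2)%:E)) => [m|m x _].
      by apply: measurable_funS (measurable_sqr (mff n m)).
    by rewrite lee_fin sqr_ge0.
  rewrite limn_einf_lim; apply: lime_le; first exact: is_cvg_einfs.
  exists n => // m /= nm; apply: (@le_trans _ _ (\int[mu]_(x in A) ((f m x - f n x) ^+ 2)%:E)%E).
    by apply: ereal_inf_lbound; exists m => //=.
  apply: le_trans (f_cauchy nm); apply: ge0_subset_integral => //; first exact: measurable_sqr.
  by move=> x _; rewrite lee_fin sqr_ge0.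
exists g; split => //.
have : sq_integrable (fun x => f 0%N x - g x).
  by split => //; apply: le_lt_trans (fg 0%N) _; exact: ltry.
move=> /(sq_integrable_weight (bounded_on_cst (-1))) /(sq_integrableD (Lf 0%N)).
rewrite (_ : (f 0%N \+ _) = g)//.
by apply/funext => x /=; ring.
Qed.
End complete.
End square_integrable.

(** * Complex functions and weighted products *)

Section complex_parts.
Context {R : realType}.
Implicit Types z w : R[i].
Lemma re_add z w : Re (z + w) = Re z + Re w. Proof. by case: z w => ? ? [? ?]. Qed.
Lemma im_add z w : Im (z + w) = Im z + Im w. Proof. by case: z w => ? ? [? ?]. Qed.
Lemma re_mul z w : Re (z * w) = Re z * Re w - Im z * Im w.
Proof. by case: z w => ? ? [? ?]. Qed.
Lemma im_mul z w : Im (z * w) = Re z * Im w + Im z * Re w.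
Proof. by case: z w => ? ? [? ?]. Qed.
Lemma re_conj z : Re (conjc z) = Re z. Proof. by case: z. Qed.
Lemma im_conj z : Im (conjc z) = - Im z. Proof. by case: z. Qed.
Lemma complex_eq z w : Re z = Re w -> Im z = Im w -> z = w.
Proof. by case: z w => ? ? [? ?] /= -> ->. Qed.
Lemma re_sum (I : Type) (s : seq I) (F : I -> R[i]) :
  Re (\sum_(i <- s) F i) = \sum_(i <- s) Re (F i).
Proof. exact: (big_morph (@Re R) re_add erefl). Qed.
Lemma im_sum (I : Type) (s : seq I) (F : I -> R[i]) :
  Im (\sum_(i <- s) F i) = \sum_(i <- s) Im (F i).
Proof. exact: (big_morph (@Im R) im_add erefl). Qed.
Definition reimE := (re_add, im_add, re_mul, im_mul, re_conj, im_conj).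
End complex_parts.

Section complex_L2.
Context {R : realType} {d : nat}.
Variable U : set 'rV[R]_d.
Local Notation mu := (lebesgue_rV d : {measure set 'rV[R]_d -> \bar R}).
Hypothesis mU : measurable U.
Hypothesis muU : (mu U < +oo)%E.
Implicit Types (p q r : scalar_field R d) (v w u : vector_field R d).
Implicit Types (a : 'rV[R]_d -> R).
Local Notation sqi := (sq_integrable mu U).

Definition cintegrable q :=
  mu.-integrable U (EFin \o (fun x => Re (q x))) /\
  mu.-integrable U (EFin \o (fun x => Im (q x))).

Lemma cintegrable_lin z p q : cintegrable p -> cintegrable q ->
  cintegrable (fun x => p x + z * q x).
Proof.
move=> [pr pim] [qr qi]; split.
  have := integrableD mU pr (integrableB mU (integrableZl mU (Re z) qr) (integrableZl mU (Im z) qi)).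
  by apply: eq_integrable => // x _; rewrite /= !reimE.
have := integrableD mU pim (integrableD mU (integrableZl mU (Re z) qi) (integrableZl mU (Im z) qr)).
by apply: eq_integrable => // x _; rewrite /= !reimE.
Qed.

Lemma cintegral_lin z p q : cintegrable p -> cintegrable q ->
  cintegral U (fun x => p x + z * q x) = cintegral U p + z * cintegral U q.
Proof.
move=> [pr pim] [qr qi].
have Z (c : R) f : mu.-integrable U (EFin \o f) -> mu.-integrable U (EFin \o (fun x => c * f x)).
  by move=> /(integrableZl mU c); apply: eq_integrable.
apply: complex_eq; rewrite !reimE /cintegral/=.
  rewrite -!RintegralZl// -RintegralB ?Z// -RintegralD//; last first.
    by apply: eq_integrable (integrableB mU (Z (Re z) _ qr) (Z (Im z) _ qi)).
  by apply: eq_Rintegral => x _; rewrite !reimE.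
rewrite -!RintegralZl// -RintegralD ?Z// -RintegralD//; last first.
  by apply: eq_integrable (integrableD mU (Z (Re z) _ qi) (Z (Im z) _ qr)).
by apply: eq_Rintegral => x _; rewrite !reimE.
Qed.

Lemma eq_cintegral p q : (forall x, U x -> p x = q x) ->
  cintegral U p = cintegral U q.
Proof.
by move=> pq; congr Complex; apply: eq_Rintegral => x /[!inE] /pq ->.
Qed.

Lemma cintegral0 : cintegral U (fun=> 0) = 0.
Proof. by rewrite /cintegral/= /Rintegral integral0. Qed.

Lemma cintegrable0 : cintegrable (fun=> 0).
Proof. by split; exact: integrable0. Qed.

Lemma cintegral_sum (I : Type) (s : seq I) (p : I -> scalar_field R d) :
  (forall i, cintegrable (p i)) ->
  cintegrable (fun x => \sum_(i <- s) p i x) /\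
  cintegral U (fun x => \sum_(i <- s) p i x) = \sum_(i <- s) cintegral U (p i).
Proof.
move=> ip; elim: s => [|i s [IH1 IH2]].
  have -> : (fun x => \sum_(i <- [::]) p i x) = fun=> 0 by apply/funext => x; rewrite big_nil.
  by rewrite big_nil; split; [exact: cintegrable0|exact: cintegral0].
have -> : (fun x => \sum_(j <- i :: s) p j x) = fun x => p i x + 1 * \sum_(j <- s) p j x.
  by apply/funext => x; rewrite big_cons mul1r.
split; first exact: cintegrable_lin.
by rewrite cintegral_lin// mul1r IH2 big_cons.
Qed.

Lemma ae_eq_cintegral p q : cintegrable p -> cintegrable q ->
  {ae mu, forall x, U x -> p x = q x} -> cintegral U p = cintegral U q.
Proof.
move=> [pr pim] [qr qi] pq.
congr Complex; congr fine; apply: ae_eq_integral => //;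
  try exact: measurable_int; try exact: (measurable_int _ pr);
  try exact: (measurable_int _ pim); try exact: (measurable_int _ qr);
  try exact: (measurable_int _ qi);
  by apply: filterS pq => x h Ux; rewrite h.
Qed.

Lemma L2P q : L2 U q <-> sqi (fun x => Re (q x)) /\ sqi (fun x => Im (q x)).
Proof.
have S (f : 'rV[R]_d -> R) : measurable_fun U f -> measurable_fun U (fun x => (f x ^+ 2)%:E).
  exact: measurable_sqr.
have E : measurable_fun U (fun x => Re (q x)) -> measurable_fun U (fun x => Im (q x)) ->
  (\int[mu]_(x in U) (Re (q x) ^+ 2 + Im (q x) ^+ 2)%:E =
   \int[mu]_(x in U) (Re (q x) ^+ 2)%:E + \int[mu]_(x in U) (Im (q x) ^+ 2)%:E)%E.
  move=> mr mi; under eq_integral do rewrite EFinD.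
  by rewrite ge0_integralD//=; try (by move=> x _; rewrite lee_fin sqr_ge0); exact: S.
have I0 (f : 'rV[R]_d -> R) : (0 <= \int[mu]_(x in U) (f x ^+ 2)%:E)%E.
  by apply: integral_ge0 => x _; rewrite lee_fin sqr_ge0.
split=> [[mr mi]|[[mr ir] [mi ii]]].
  rewrite E// => h; split; split => //; apply: le_lt_trans h.
    by rewrite leeDl.
  by rewrite leeDr.
split => //; rewrite E//.
by rewrite lte_add_pinfty.
Qed.

Lemma L2_lin z p q : L2 U p -> L2 U q -> L2 U (fun x => p x + z * q x).
Proof.
move=> /L2P[pr pim] /L2P[qr qi]; 
have Z c f := @sq_integrable_weight _ _ _ mu U mU _ f (bounded_on_cst U c).
apply/L2P; split.
  have := sq_integrableD mU pr (sq_integrableD mU (Z (Re z) _ qr) (Z (- Im z) _ qi)).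
  by congr sq_integrable; apply/funext => x /=; rewrite !reimE mulNr.
have := sq_integrableD mU pim (sq_integrableD mU (Z (Re z) _ qi) (Z (Im z) _ qr)).
by congr sq_integrable; apply/funext => x /=; rewrite !reimE.
Qed.

Lemma L2_conj p : L2 U p -> L2 U (fun x => conjc (p x)).
Proof.
move=> /L2P[pr pim]; 
have Z c f := @sq_integrable_weight _ _ _ mu U mU _ f (bounded_on_cst U c).
apply/L2P; split.
  by move: pr; congr sq_integrable; apply/funext => x /=; rewrite !reimE.
have := Z (-1) _ pim.
by congr sq_integrable; apply/funext => x /=; rewrite !reimE mulN1r.
Qed.

Lemma L2_bounded a : bounded_on U a -> L2 U (fun x => (a x)%:C).
Proof.
move=> ba; apply/L2P; split => /=; first exact: sq_integrable_bounded.
by apply: sq_integrable_bounded => //; exact: (bounded_on_cst U 0).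
Qed.

Lemma L2_0 : L2 U (fun=> 0).
Proof. exact: (L2_bounded (bounded_on_cst U 0)). Qed.

Lemma cintegrableM p q : L2 U p -> L2 U q -> cintegrable (fun x => p x * q x).
Proof.
move=> /L2P[pr pim] /L2P[qr qi].
have X f g := @sq_integrable_integrableM _ _ _ mu U mU f g.
split.
  have := integrableB mU (X _ _ pr qr) (X _ _ pim qi).
  by apply: eq_integrable => // x _; rewrite /= !reimE.
have := integrableD mU (X _ _ pr qi) (X _ _ pim qr).
by apply: eq_integrable => // x _; rewrite /= !reimE.
Qed.

Lemma L2_weight a p : bounded_on U a -> L2 U p -> L2 U (fun x => (a x)%:C * p x).
Proof.
move=> ba /L2P[pr pim]; apply/L2P; split.
  have := sq_integrable_weight mU ba pr.
  by congr sq_integrable; apply/funext => x /=; rewrite !reimE/= mul0r subr0.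
have := sq_integrable_weight mU ba pim.
by congr sq_integrable; apply/funext => x /=; rewrite !reimE/= mul0r addr0.
Qed.

(** [mass] is a sum of such products over the coordinates, [divdiv] is the one
    of the divergences. *)
Definition wdot a p q : R[i] :=
  cintegral U (fun x => (a x)%:C * (p x * conjc (q x))).

Lemma cintegrable_wdot a p q : bounded_on U a -> L2 U p -> L2 U q ->
  cintegrable (fun x => (a x)%:C * (p x * conjc (q x))).
Proof.
move=> ba Lp Lq; under eq_fun do rewrite mulrA.
by apply: cintegrableM; [exact: L2_weight|exact: L2_conj].
Qed.

Lemma wdot_lin a z p q r : bounded_on U a -> L2 U p -> L2 U q -> L2 U r ->
  wdot a (fun x => p x + z * q x) r = wdot a p r + z * wdot a q r.
Proof.
move=> ba Lp Lq Lr; rewrite /wdot -cintegral_lin; try exact: cintegrable_wdot.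
by apply: eq_cintegral => x _; ring.
Qed.

Lemma wdot_conj a p q : bounded_on U a -> L2 U p -> L2 U q ->
  wdot a q p = conjc (wdot a p q).
Proof.
move=> ba Lp Lq; have [_ i] := cintegrable_wdot ba Lp Lq.
rewrite /wdot; apply: complex_eq; rewrite !reimE /cintegral/=.
  by apply: eq_Rintegral => x _; rewrite !reimE/=; ring.
rewrite -[RHS]mulN1r -RintegralZl//.
by apply: eq_Rintegral => x _; rewrite !reimE/=; ring.
Qed.

Lemma ae_eq_wdot a p p' q : bounded_on U a -> L2 U p -> L2 U p' -> L2 U q ->
  {ae mu, forall x, U x -> p x = p' x} -> wdot a p q = wdot a p' q.
Proof.
move=> ba Lp Lp' Lq pp'; apply: ae_eq_cintegral; try exact: cintegrable_wdot.
by apply: filterS pp' => x h Ux; rewrite h.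
Qed.

Lemma wdot_diag a p : wdot a p p =
  (\int[mu]_(x in U) (a x * (Re (p x) ^+ 2 + Im (p x) ^+ 2)))%:C.
Proof.
apply: complex_eq; rewrite /wdot /cintegral/=.
  by apply: eq_Rintegral => x _; rewrite !reimE/=; ring.
transitivity (\int[mu]_(x in U) (0 : R)); last by rewrite Rintegral_cst// mul0r.
by apply: eq_Rintegral => x _; rewrite !reimE/=; ring.
Qed.

Lemma wdot_diag_ge0 a p : (forall x, U x -> 0 <= a x) -> 0 <= Re (wdot a p p).
Proof.
move=> a0; rewrite wdot_diag/=; apply: Rintegral_ge0 => x Ux.
by rewrite mulr_ge0 ?a0// addr_ge0 ?sqr_ge0.
Qed.

Lemma integrable_diag a p : bounded_on U a -> L2 U p ->
  mu.-integrable U (EFin \o (fun x => a x * (Re (p x) ^+ 2 + Im (p x) ^+ 2))).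
Proof.
move=> ba Lp; have [+ _] := cintegrable_wdot ba Lp Lp.
by apply: eq_integrable => // x _; rewrite /= !reimE/=; congr EFin; ring.
Qed.

(** An integrand which is nonnegative with zero integral vanishes. *)
Lemma wdot_diag_eq0 a p : bounded_on U a -> (forall x, U x -> 0 < a x) -> L2 U p ->
  Re (wdot a p p) = 0 -> {ae mu, forall x, U x -> p x = 0}.
Proof.
move=> ba a0 Lp; rewrite wdot_diag/= => h.
have id := integrable_diag ba Lp.
have h0 : (\int[mu]_(x in U) `|(a x * (Re (p x) ^+ 2 + Im (p x) ^+ 2))%:E| = 0)%E.
  rewrite -[RHS]/(0%R)%:E -h /Rintegral fineK; last exact: integrable_fin_num.
  apply: eq_integral => x /[!inE] Ux; rewrite gee0_abs// lee_fin.
  by apply: mulr_ge0; [exact/ltW/a0|rewrite addr_ge0 ?sqr_ge0].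
have := (ae_eq_integral_abs mu mU (measurable_int _ id)).1 h0.
apply: filterS => x /= hx Ux; have /eqP := hx Ux.
rewrite eqe mulf_eq0 gt_eqF ?a0//= paddr_eq0 ?sqr_ge0// !sqrf_eq0 => /andP[/eqP h1 /eqP h2].
exact: complex_eq.
Qed.

End complex_L2.

(** * Vector fields and weak divergences *)

Section fields.
Context {R : realType} {d : nat}.
Variable U : set 'rV[R]_d.
Local Notation mu := (lebesgue_rV d : {measure set 'rV[R]_d -> \bar R}).
Hypothesis U_open : open U.
Hypothesis U_bounded : bounded_set U.
Implicit Types (p q r : scalar_field R d) (v w u k : vector_field R d).
Implicit Types (a : 'rV[R]_d -> R).

Let mU : measurable U := open_measurable_rV U_open.
Let muU : (mu U < +oo)%E := lebesgue_rV_bounded mU U_bounded.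

(** [U] is contained in a compact box. *)
Lemma bounded_on_continuous (f : 'rV[R]_d -> R) : continuous f -> bounded_on U f.
Proof.
move=> cf; split; first by apply: measurable_funTS; exact: continuous_measurable_rV.
have [N UN] := bounded_set_sub_cbox U_bounded.
have /compact_bounded[M [_ hM]] : compact (f @` cbox (const_mx (- N)) (const_mx N)).
  by apply: continuous_compact; [exact: continuous_subspaceT|exact: compact_cbox].
exists (M + 1) => x Ux; apply: (hM (M + 1)); first by rewrite ltrDl.
by exists x => //; exact: UN.
Qed.

Section mass.
Variable a : 'rV[R]_d -> R.
Hypothesis ba : bounded_on U a.

Lemma mass_wdot v w : L2v U v -> L2v U w ->
  mass U a v w = \sum_i wdot U a (fun x => v x ord0 i) (fun x => w x ord0 i).
Proof.
move=> Lv Lw; have h i : cintegrable U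
    (fun x => (a x)%:C * (v x ord0 i * conjc (w x ord0 i))).
  by apply: cintegrable_wdot.
have [_ <-] := cintegral_sum mU (index_enum 'I_d) h.
by apply: eq_cintegral => x _; rewrite mulr_sumr.
Qed.

Lemma L2v_lin (z : R[i]) v w : L2v U v -> L2v U w -> L2v U (v + z *: w).
Proof.
move=> Lv Lw i; have := L2_lin mU z (Lv i) (Lw i).
by congr L2; apply/funext => x; rewrite !mxE.
Qed.

Lemma mass_lin (z : R[i]) v w u : L2v U v -> L2v U w -> L2v U u ->
  mass U a (v + z *: w) u = mass U a v u + z * mass U a w u.
Proof.
move=> Lv Lw Lu; rewrite !mass_wdot//; last exact: L2v_lin.
rewrite mulr_sumr -big_split/=; apply: eq_bigr => i _.
rewrite -wdot_lin//; apply: eq_cintegral => x _.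
by rewrite !mxE.
Qed.

Lemma mass_conj v w : L2v U v -> L2v U w -> mass U a w v = conjc (mass U a v w).
Proof.
move=> Lv Lw; rewrite !mass_wdot// rmorph_sum; apply: eq_bigr => i _.
exact: wdot_conj.
Qed.

Lemma mass_linr (z : R[i]) v w u : L2v U v -> L2v U w -> L2v U u ->
  mass U a u (v + z *: w) = mass U a u v + conjc z * mass U a u w.
Proof.
move=> Lv Lw Lu; rewrite mass_conj//; last exact: L2v_lin.
by rewrite mass_lin// (mass_conj Lv Lu) (mass_conj Lw Lu) rmorphD rmorphM.
Qed.

Lemma ae_eq_mass v v' w : L2v U v -> L2v U v' -> L2v U w ->
  {ae mu, forall x, U x -> v x = v' x} -> mass U a v w = mass U a v' w.
Proof.
move=> Lv Lv' Lw vv'; rewrite !mass_wdot//; apply: eq_bigr => i _.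
by apply: ae_eq_wdot => //; apply: filterS vv' => x h Ux; rewrite h.
Qed.

Lemma mass_diag v : L2v U v ->
  Re (mass U a v v) = \sum_i Re (wdot U a (fun x => v x ord0 i) (fun x => v x ord0 i)).
Proof.
by move=> Lv; rewrite mass_wdot// re_sum.
Qed.

Lemma mass_diag_ge0 v : (forall x, U x -> 0 <= a x) -> L2v U v -> 0 <= Re (mass U a v v).
Proof.
by move=> a0 Lv; rewrite mass_diag// sumr_ge0// => i _; exact: wdot_diag_ge0.
Qed.

Lemma mass_diag_eq0 v : (forall x, U x -> 0 < a x) -> L2v U v ->
  Re (mass U a v v) = 0 -> {ae mu, forall x, U x -> v x = 0}.
Proof.
move=> a0 Lv; rewrite mass_diag// => /eqP; rewrite psumr_eq0; last first.
  by move=> i _; apply: wdot_diag_ge0 => [|x Ux]; [exact: mU|]; exact/ltW/a0.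
move=> /allP h.
have h0 i : {ae mu, forall x, U x -> v x ord0 i = 0}.
  apply: (wdot_diag_eq0 mU ba a0 (Lv i)).
  by apply/eqP/h; exact: mem_index_enum.
have := @filter_forall _ _ _ _ (ae_filter_ringOfSetsType mu) h0.
by apply: filterS => x hx Ux; apply/rowP => i; rewrite mxE; exact: hx.
Qed.
End mass.

Lemma bounded_on1 : bounded_on U (cst 1 : 'rV[R]_d -> R).
Proof. exact: bounded_on_cst. Qed.

(** The pairings which define weak divergences and normal traces are bilinear;
    they are the sesquilinear products with the conjugate of the second
    argument. *)
Definition vpair v w := cintegral U (fun x => \sum_i v x ord0 i * w x ord0 i).
Definition spair p q := cintegral U (fun x => p x * q x).
Definition vconj v : vector_field R d := fun x => map_mx conjc (v x).

Lemma L2v_conj v : L2v U v -> L2v U (vconj v).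
Proof.
move=> Lv i; have := L2_conj mU (Lv i).
by congr L2; apply/funext => x; rewrite /vconj mxE.
Qed.

Lemma vpair_mass v w : vpair v w = mass U (cst 1) v (vconj w).
Proof.
apply: eq_cintegral => x _; rewrite mul1r; apply: eq_bigr => i _.
by rewrite /vconj mxE conjcK.
Qed.

Lemma vpair_lin (z : R[i]) v v' w : L2v U v -> L2v U v' -> L2v U w ->
  vpair (v + z *: v') w = vpair v w + z * vpair v' w.
Proof.
move=> Lv Lv' Lw; rewrite !vpair_mass mass_lin//; [exact: bounded_on1|exact: L2v_conj].
Qed.

Lemma ae_eq_vpair v v' w : L2v U v -> L2v U v' -> L2v U w ->
  {ae mu, forall x, U x -> v x = v' x} -> vpair v w = vpair v' w.
Proof.
move=> Lv Lv' Lw vv'; rewrite !vpair_mass; apply: ae_eq_mass => //.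
  exact: bounded_on1.
exact: L2v_conj.
Qed.

Lemma spair_lin (z : R[i]) p q r : L2 U p -> L2 U q -> L2 U r ->
  spair (fun x => p x + z * q x) r = spair p r + z * spair q r.
Proof.
move=> Lp Lq Lr; rewrite /spair -cintegral_lin//; try exact: cintegrableM.
by apply: eq_cintegral => x _; ring.
Qed.

Lemma ae_eq_spair p q r : L2 U p -> L2 U q -> L2 U r ->
  {ae mu, forall x, U x -> p x = q x} -> spair p r = spair q r.
Proof.
move=> Lp Lq Lr pq; apply: ae_eq_cintegral => //; try exact: cintegrableM.
by apply: filterS pq => x h Ux; rewrite h.
Qed.

Definition cgrad (f : 'rV[R]_d -> R) : vector_field R d :=
  fun x => \row_i ('D_(ev i) f x)%:C.

Lemma L2_test f : test_function U f -> L2 U (fun x => (f x)%:C).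
Proof.
move=> [/(_ 0%N) [cf _] _ _].
by apply: L2_bounded => //; exact: bounded_on_continuous.
Qed.

Lemma L2v_cgrad f : test_function U f -> L2v U (cgrad f).
Proof.
move=> [/(_ 1%N) [_ h] _ _] i; have [_ [cf _]] := h i.
have := L2_bounded mU muU (bounded_on_continuous cf).
by congr L2; apply/funext => x; rewrite /cgrad mxE.
Qed.

Lemma is_weak_divP v q : is_weak_div U v q <->
  forall f, test_function U f -> vpair v (cgrad f) = - spair q (fun x => (f x)%:C).
Proof.
have E (f : 'rV[R]_d -> R) :
    cintegral U (fun x => \sum_i v x ord0 i * ('D_(ev i) f x)%:C) = vpair v (cgrad f).
  apply: eq_cintegral => x _; apply: eq_bigr => i _; by rewrite /cgrad mxE.
by split => h f tf; have := h f tf; rewrite E.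
Qed.

Lemma is_weak_div_lin (z : R[i]) v w p q : L2v U v -> L2v U w -> L2 U p -> L2 U q ->
  is_weak_div U v p -> is_weak_div U w q ->
  is_weak_div U (v + z *: w) (fun x => p x + z * q x).
Proof.
move=> Lv Lw Lp Lq /is_weak_divP hv /is_weak_divP hw; apply/is_weak_divP => f tf.
have Lf := L2_test tf; have Lg := L2v_cgrad tf.
by rewrite vpair_lin// spair_lin// hv// hw// mulrN opprD.
Qed.

(** Two weak divergences have the same integrals against test functions. *)
Lemma weak_div_unique v p q : L2 U p -> L2 U q ->
  is_weak_div U v p -> is_weak_div U v q -> {ae mu, forall x, U x -> p x = q x}.
Proof.
move=> Lp Lq /is_weak_divP hp /is_weak_divP hq.
pose r x := p x + (-1) * q x.
have Lr : L2 U r by exact: L2_lin.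
have hr f : test_function U f -> spair r (fun x => (f x)%:C) = 0.
  move=> tf; rewrite spair_lin//; last exact: L2_test.
  by apply/eqP; rewrite mulN1r subr_eq0 -eqr_opp -hp// -hq.
have L1 : L2 U (fun=> 1) by exact: (L2_bounded mU muU bounded_on1).
have [ir ii] := cintegrableM mU Lr L1.
have hRe : {ae mu, forall x, U x -> Re (r x) = 0}.
  apply: du_bois_reymond => //.
    by apply: eq_integrable ir => // x _ /=; rewrite !reimE/= mulr1 mulr0 subr0.
  move=> f tf; have := congr1 (@Re R) (hr f tf); rewrite /spair /cintegral/=.
  by move=> h; rewrite -[RHS]h; apply: eq_Rintegral => x _; rewrite !reimE/= mulr0 subr0.
have hIm : {ae mu, forall x, U x -> Im (r x) = 0}.
  apply: du_bois_reymond => //.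
    by apply: eq_integrable ii => // x _ /=; rewrite !reimE/= mulr1 mulr0 add0r.
  move=> f tf; have := congr1 (@Im R) (hr f tf); rewrite /spair /cintegral/=.
  by move=> h; rewrite -[RHS]h; apply: eq_Rintegral => x _; rewrite !reimE/= mulr0 add0r.
apply: filterS2 hRe hIm => x h1 h2 Ux; apply/eqP; rewrite -subr_eq0 -mulN1r.
by apply/eqP/complex_eq; [exact: h1|exact: h2].
Qed.

Lemma weak_div_spec v : Hdiv U v ->
  [/\ L2v U v, L2 U (weak_div U v) & is_weak_div U v (weak_div U v)].
Proof.
by move=> [Lv hv]; have [] := xgetPex (fun=> 0) hv.
Qed.

Lemma weak_div_eq v q : Hdiv U v -> L2 U q -> is_weak_div U v q ->
  {ae mu, forall x, U x -> weak_div U v x = q x}.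
Proof. by move=> /weak_div_spec[_ L1 h1] L2 h2; exact: weak_div_unique h1 h2. Qed.

Lemma Hdiv_lin (z : R[i]) v w : Hdiv U v -> Hdiv U w -> Hdiv U (v + z *: w).
Proof.
move=> /weak_div_spec[Lv Ldv hv] /weak_div_spec[Lw Ldw hw].
split; first exact: L2v_lin.
exists (fun x => weak_div U v x + z * weak_div U w x).
by split; [exact: L2_lin|exact: is_weak_div_lin].
Qed.

Lemma weak_div_lin (z : R[i]) v w : Hdiv U v -> Hdiv U w ->
  {ae mu, forall x, U x -> weak_div U (v + z *: w) x = weak_div U v x + z * weak_div U w x}.
Proof.
move=> hv hw; have := weak_div_spec hv; have := weak_div_spec hw => -[Lw Ldw dw] [Lv Ldv dv].
apply: weak_div_eq; [exact: Hdiv_lin|exact: L2_lin|exact: is_weak_div_lin].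
Qed.

Lemma is_weak_div_ae v w q : L2v U v -> L2v U w ->
  {ae mu, forall x, U x -> v x = w x} -> is_weak_div U v q -> is_weak_div U w q.
Proof.
move=> Lv Lw vw /is_weak_divP hv; apply/is_weak_divP => f tf.
by rewrite -hv//; apply/esym/ae_eq_vpair => //; exact: L2v_cgrad.
Qed.

Lemma weak_div_ae v w : Hdiv U v -> Hdiv U w ->
  {ae mu, forall x, U x -> v x = w x} ->
  {ae mu, forall x, U x -> weak_div U v x = weak_div U w x}.
Proof.
move=> hv hw vw; have [Lw Ldw dw] := weak_div_spec hw; have [Lv _ _] := weak_div_spec hv.
apply: weak_div_eq => //; apply: is_weak_div_ae dw => //.
by apply: filterS vw => x h Ux; rewrite h.
Qed.

Lemma H0div_lin (z : R[i]) v w : H0div U v -> H0div U w -> H0div U (v + z *: w).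
Proof.
move=> [hv tv] [hw tw]; split; first exact: Hdiv_lin.
move=> phi u Lphi Lu gu.
have [Lv Ldv dv] := weak_div_spec hv; have [Lw Ldw dw] := weak_div_spec hw.
have [_ Ld _] := weak_div_spec (Hdiv_lin z hv hw).
rewrite -/(vpair _ _) -/(spair _ _) vpair_lin//.
rewrite (ae_eq_spair Ld (L2_lin mU z Ldv Ldw) Lphi (weak_div_lin z hv hw)) spair_lin//.
by rewrite addrACA (tv phi u)// -mulrDr (tw phi u)// mulr0 addr0.
Qed.

Lemma divdiv_wdot a v w : divdiv U a v w = wdot U a (weak_div U v) (weak_div U w).
Proof. by []. Qed.

Lemma divdiv_lin a (z : R[i]) v w u : bounded_on U a -> Hdiv U v -> Hdiv U w -> Hdiv U u ->
  divdiv U a (v + z *: w) u = divdiv U a v u + z * divdiv U a w u.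
Proof.
move=> ba hv hw hu; rewrite !divdiv_wdot.
have [_ Ldv _] := weak_div_spec hv; have [_ Ldw _] := weak_div_spec hw.
have [_ Ldu _] := weak_div_spec hu.
have [_ Ld _] := weak_div_spec (Hdiv_lin z hv hw).
rewrite (ae_eq_wdot mU ba Ld (L2_lin mU z Ldv Ldw) Ldu (weak_div_lin z hv hw)).
exact: wdot_lin.
Qed.

Lemma divdiv_conj a v w : bounded_on U a -> Hdiv U v -> Hdiv U w ->
  divdiv U a w v = conjc (divdiv U a v w).
Proof.
move=> ba /weak_div_spec[_ Lv _] /weak_div_spec[_ Lw _]; exact: wdot_conj.
Qed.

Lemma divdiv_linr a (z : R[i]) v w u : bounded_on U a -> Hdiv U v -> Hdiv U w -> Hdiv U u ->
  divdiv U a u (v + z *: w) = divdiv U a u v + conjc z * divdiv U a u w.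
Proof.
move=> ba hv hw hu; rewrite divdiv_conj//; last exact: Hdiv_lin.
by rewrite divdiv_lin// (divdiv_conj ba hv hu) (divdiv_conj ba hw hu) rmorphD rmorphM.
Qed.

Lemma ae_eq_divdiv a v v' w : bounded_on U a -> Hdiv U v -> Hdiv U v' -> Hdiv U w ->
  {ae mu, forall x, U x -> v x = v' x} -> divdiv U a v w = divdiv U a v' w.
Proof.
move=> ba hv hv' hw vv'; rewrite !divdiv_wdot.
have [_ Ldv _] := weak_div_spec hv; have [_ Ldw _] := weak_div_spec hw.
have [_ Ldv' _] := weak_div_spec hv'.
by apply: ae_eq_wdot => //; exact: weak_div_ae.
Qed.

Lemma divdiv_div0 a v w : bounded_on U a -> Hdiv U v -> Hdiv U w ->
  {ae mu, forall x, U x -> weak_div U w x = 0} ->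
  divdiv U a v w = 0.
Proof.
move=> ba hv hw w0; rewrite divdiv_conj// divdiv_wdot.
have [_ Ldv _] := weak_div_spec hv; have [_ Ldw _] := weak_div_spec hw.
rewrite (ae_eq_wdot mU ba Ldw (L2_0 mU muU) Ldv w0).
rewrite /wdot (eq_cintegral (q := fun=> 0)) ?cintegral0 ?rmorph0// => x _.
by rewrite mul0r mulr0.
Qed.
End fields.

(** * Completeness of the square-integrable vector fields *)

Section completeness.
Context {R : realType} {d : nat}.
Variable U : set 'rV[R]_d.
Local Notation mu := (lebesgue_rV d : {measure set 'rV[R]_d -> \bar R}).
Hypothesis U_open : open U.
Hypothesis U_bounded : bounded_set U.
Implicit Types (p q r : scalar_field R d) (v w u k : vector_field R d).

Let mU : measurable U := open_measurable_rV U_open.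
Let muU : (mu U < +oo)%E := lebesgue_rV_bounded mU U_bounded.
Local Notation b1 := (bounded_on1 U).

Lemma wdot_le (a b : 'rV[R]_d -> R) (M : R) p : bounded_on U a -> bounded_on U b ->
  (forall x, U x -> a x <= M * b x) -> L2 U p ->
  Re (wdot U a p p) <= M * Re (wdot U b p p).
Proof.
move=> ba bb ab Lp; rewrite !wdot_diag//= -RintegralZl//; last exact: integrable_diag.
apply: le_Rintegral => //; first exact: integrable_diag.
  by have := integrableZl mU M (integrable_diag mU bb Lp); apply: eq_integrable.
by move=> x Ux; rewrite mulrA ler_wpM2r ?ab// addr_ge0 ?sqr_ge0.
Qed.

(** Extended real integrals are what the completeness theorem for real functions
    speaks of. *)
Lemma wdot1E p : L2 U p ->
  (\int[mu]_(x in U) (Re (p x) ^+ 2)%:E + \int[mu]_(x in U) (Im (p x) ^+ 2)%:E =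
   (Re (wdot U (cst 1) p p))%:E)%E.
Proof.
move=> Lp; have /(L2P mU)[pr pim] := Lp.
have id := integrable_diag mU b1 Lp.
rewrite wdot_diag//= /Rintegral fineK; last exact: (integrable_fin_num mU id).
under [RHS]eq_integral do rewrite mul1r EFinD.
rewrite ge0_integralD//; try by (move=> x _; rewrite lee_fin sqr_ge0).
  by apply: measurable_sqr; exact: pr.1.
by apply: measurable_sqr; exact: pim.1.
Qed.

Lemma wdot_complete (p : nat -> scalar_field R d) (C : R) : (forall n, L2 U (p n)) ->
  (forall n m, (n <= m)%N ->
    Re (wdot U (cst 1) (fun x => p m x - p n x) (fun x => p m x - p n x)) <= C * (4^-1) ^+ n) ->
  exists q, L2 U q /\ forall n,
    Re (wdot U (cst 1) (fun x => p n x - q x) (fun x => p n x - q x)) <= (C *+ 2) * (4^-1) ^+ n.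
Proof.
move=> Lp hp.
have LB p1 q1 : L2 U p1 -> L2 U q1 -> L2 U (fun x => p1 x - q1 x).
  move=> L1 L2'; have := L2_lin mU (-1) L1 L2'.
  by congr L2; apply/funext => x; rewrite mulN1r.
have I0 (f : 'rV[R]_d -> R) : (0 <= \int[mu]_(x in U) (f x ^+ 2)%:E)%E.
  by apply: integral_ge0 => x _; rewrite lee_fin sqr_ge0.
have ReB (z w : R[i]) : Re (z - w) = Re z - Re w by case: z w => ? ? [].
have ImB (z w : R[i]) : Im (z - w) = Im z - Im w by case: z w => ? ? [].
have [n|n m nm|g [Lg hg]] := @sq_integrable_complete _ _ _ mu U mU muU (fun n x => Re (p n x)) C.
- by have /(L2P mU)[] := Lp n.
- have := hp n m nm; rewrite -lee_fin -wdot1E; last exact: LB.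
  apply: le_trans; under eq_integral do rewrite -ReB.
  by rewrite leeDl.
have [n|n m nm|h [Lh hh]] := @sq_integrable_complete _ _ _ mu U mU muU (fun n x => Im (p n x)) C.
- by have /(L2P mU)[] := Lp n.
- have := hp n m nm; rewrite -lee_fin -wdot1E; last exact: LB.
  apply: le_trans; under eq_integral do rewrite -ImB.
  by rewrite leeDr.
have Lq : L2 U (fun x => Complex (g x) (h x)) by apply/(L2P mU).
exists (fun x => Complex (g x) (h x)); split => // n.
rewrite -lee_fin -wdot1E; last exact: LB.
under eq_integral do rewrite ReB.
under [X in (_ + X)%E]eq_integral do rewrite ImB.
by rewrite mulrnAl mulr2n EFinD leeD.
Qed.

Let le_of_eq (x y : R) : x = y -> x <= y. Proof. by move=> ->. Qed.

Lemma L2v_complete (k : nat -> vector_field R d) (C : R) : (forall n, L2v U (k n)) ->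
  (forall n m, (n <= m)%N ->
    Re (mass U (cst 1) (k m - k n) (k m - k n)) <= C * (4^-1) ^+ n) ->
  exists k', L2v U k' /\ exists C' : R, forall n,
    Re (mass U (cst 1) (k n - k') (k n - k')) <= C' * (4^-1) ^+ n.
Proof.
move=> Lk hk.
have LB v w : L2v U v -> L2v U w -> L2v U (v - w).
  by move=> Lv Lw; rewrite -scaleN1r; exact: L2v_lin.
have /choice[q hq] (i : 'I_d) : exists q, L2 U q /\ forall n,
    Re (wdot U (cst 1) (fun x => k n x ord0 i - q x) (fun x => k n x ord0 i - q x))
    <= (C *+ 2) * (4^-1) ^+ n.
  apply: wdot_complete => [n|n m nm]; first exact: Lk.
  apply: le_trans (hk n m nm); rewrite mass_diag//; [|exact: b1|exact: LB].
  rewrite (bigD1 i)//= -[leLHS]addr0; apply: lerD; last first.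
    by apply: sumr_ge0 => j _; apply: wdot_diag_ge0.
  by apply: le_of_eq; apply: eq_Rintegral => x _; rewrite !mxE.
pose k' : vector_field R d := fun x => \row_i q i x.
have Lk' : L2v U k'.
  by move=> i; have := (hq i).1; congr L2; apply/funext => x; rewrite mxE.
exists k'; split => //; exists (\sum_(i < d) C *+ 2) => n.
rewrite mass_diag//; [|exact: b1|exact: LB].
rewrite mulr_suml; apply: ler_sum => i _; apply: le_trans ((hq i).2 n).
by apply: le_of_eq; congr (Re _); apply: eq_cintegral => x _; rewrite !mxE.
Qed.

Section real_form.
Variable a : 'rV[R]_d -> R.
Hypothesis ba : bounded_on U a.
Hypothesis a0 : forall x, U x -> 0 <= a x.

Lemma L2v_closed (t : R) v w : L2v U v -> L2v U w -> L2v U (v + t%:C *: w).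
Proof. exact: L2v_lin. Qed.

Lemma re_mass_linear (t : R) v w u : L2v U v -> L2v U w -> L2v U u ->
  Re (mass U a (v + t%:C *: w) u) = Re (mass U a v u) + t * Re (mass U a w u).
Proof.
by move=> Lv Lw Lu; rewrite mass_lin// !reimE /= mul0r subr0.
Qed.

Lemma re_mass_sym v w : L2v U v -> L2v U w -> Re (mass U a v w) = Re (mass U a w v).
Proof. by move=> Lv Lw; rewrite (mass_conj U_open ba Lv Lw) re_conj. Qed.

Lemma re_mass_ge0 v : L2v U v -> 0 <= Re (mass U a v v).
Proof. exact: mass_diag_ge0. Qed.

End real_form.

(** The quadratic bound is applied to the real part of the product with [y], and
    to the one with ['i *: y] for the imaginary part. *)
Lemma mass_ortho_limit (k : nat -> vector_field R d) k' y (C : R) :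
  (forall n, L2v U (k n)) -> L2v U k' -> L2v U y ->
  (forall n, Re (mass U (cst 1) (k n - k') (k n - k')) <= C * (4^-1) ^+ n) ->
  (forall n, mass U (cst 1) (k n) y = 0) -> mass U (cst 1) k' y = 0.
Proof.
move=> Lk Lk' Ly hk hy.
have Re0 u : L2v U u -> (forall n, mass U (cst 1) (k n) u = 0) ->
    Re (mass U (cst 1) k' u) = 0.
  move=> Lu hu.
  have N0 : 0 <= Re (mass U (cst 1) u u).
    by apply: (mass_diag_ge0 U_open b1) => // x _; exact: ler01.
  apply: (quadratic_bound_eq0 N0 (C := C)) => t n.
  have Lkk : L2v U (k n - k') by rewrite -scaleN1r; exact: L2v_lin.
  have E : Re (mass U (cst 1) (k n - k') u) = - Re (mass U (cst 1) k' u).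
    rewrite -scaleN1r mass_lin//; last exact: b1.
    by rewrite hu add0r mulN1r; case: mass.
  have := polarization_le L2v_closed (re_mass_linear b1) (re_mass_sym b1)
    (re_mass_ge0 b1 (fun x _ => ler01)) (- t) Lkk Lu.
  rewrite E sqrrN mulrNN.
  have := hk n; lra.
apply: complex_eq; first exact: Re0.
have L0 : L2v U (0 : vector_field R d).
  by have := L2v_lin U_open (-1) Ly Ly; rewrite scaleN1r subrr.
have Liy := L2v_lin U_open 'i L0 Ly.
have m0 u : L2v U u -> mass U (cst 1) u (0 : vector_field R d) = 0.
  move=> Lu; rewrite -[RHS](cintegral0 U); apply: eq_cintegral => x _.
  by rewrite big1 ?mulr0// => i _; rewrite mxE rmorph0 mulr0.
have := Re0 (0 + 'i *: y) Liy; rewrite mass_linr//; last exact: b1.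
rewrite m0// !add0r => h; have {h} : Re (conjc 'i * mass U (cst 1) k' y) = 0.
  apply: h => n; rewrite -[_ *: y]add0r mass_linr//; last exact: b1.
  by rewrite m0// hy mulr0 addr0.
by rewrite re_mul /= mul0r sub0r mulN1r opprK.
Qed.
End completeness.

(** * The decomposition of V and the solution operator *)

Section operator_theory.
Context {R : realType} {d : nat}.
Variable U : set 'rV[R]_d.
Local Notation mu := (lebesgue_rV d : {measure set 'rV[R]_d -> \bar R}).
Hypothesis U_open : open U.
Hypothesis U_bounded : bounded_set U.
Implicit Types (v w u k : vector_field R d).
Let mU : measurable U := open_measurable_rV U_open.
Let muU : (mu U < +oo)%E := lebesgue_rV_bounded mU U_bounded.
Local Notation b1 := (bounded_on1 U).
Local Notation field := (vector_field R d).

(* A positive lower bound of [rho] compares the weighted and the plain L2 norms;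
   the positivity of [rhoc2] makes the divergence terms definite. *)
Variables (rho c nu : 'rV[R]_d -> R) (m0 : R).
Hypothesis m0_gt0 : 0 < m0.
Hypothesis rho_ge : forall x, U x -> m0 <= rho x.
Hypothesis rhoc2_gt0 : forall x, U x -> 0 < rhoc2 rho c x.
Hypothesis brho : bounded_on U rho.
Hypothesis brhoc2 : bounded_on U (rhoc2 rho c).
Hypothesis bnu : bounded_on U nu.

Local Notation V := (spaceV U).
Local Notation K := (spaceK U).
Local Notation H := (spaceH U).
Local Notation G := (spaceG U rho c).
Local Notation rc2 := (rhoc2 rho c).

Let rho_gt0 x : U x -> 0 < rho x.
Proof. by move=> /rho_ge; exact: lt_le_trans. Qed.

Lemma L2v0 : L2v U (0 : field).
Proof.
move=> i; have := L2_0 mU muU.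
by congr L2; apply/funext => x; rewrite mxE.
Qed.

Lemma mass0l a v : mass U a (0 : field) v = 0.
Proof.
rewrite -[RHS](cintegral0 U); apply: eq_cintegral => x _.
by rewrite big1 ?mulr0// => i _; rewrite mxE mul0r.
Qed.

Lemma mass0r a v : mass U a v (0 : field) = 0.
Proof.
rewrite -[RHS](cintegral0 U); apply: eq_cintegral => x _.
by rewrite big1 ?mulr0// => i _; rewrite mxE rmorph0 mulr0.
Qed.

Lemma spaceVH v : V v -> H v. Proof. by move=> [[]]. Qed.
Lemma spaceVHdiv v : V v -> Hdiv U v. Proof. by case. Qed.

Lemma vpair0 w : vpair U (0 : field) w = 0.
Proof. by rewrite vpair_mass mass0l. Qed.

Lemma spair0 p : spair U (fun=> 0) p = 0.
Proof.
by rewrite -[RHS](cintegral0 U); apply: eq_cintegral => x _; rewrite mul0r.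
Qed.

(** For a field without divergence, both the weak divergence and the normal
    trace conditions say that it annihilates some L2 fields.  In this form [K]
    is visibly a closed subspace, and the chosen divergence is gone. *)
Lemma spaceKP k : K k <-> [/\ L2v U k,
  forall f, test_function U f -> vpair U k (cgrad f) = 0 &
  forall phi w, L2 U phi -> L2v U w -> is_weak_grad U phi w -> vpair U k w = 0].
Proof.
split=> [[[hk tk] k0]|[Lk dk tk]].
  have [Lk Ldk dk] := weak_div_spec hk.
  have sp0 p : L2 U p -> spair U (weak_div U k) p = 0.
    by move=> Lp; rewrite (ae_eq_spair U_open Ldk (L2_0 mU muU) Lp k0) spair0.
  split => // [f tf|phi w Lphi Lw g].
    by move/is_weak_divP : dk => ->//; rewrite sp0 ?oppr0//; exact: L2_test.
  have := tk phi w Lphi Lw g; rewrite -/(vpair U k w) -/(spair U _ _).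
  by rewrite sp0// addr0.
have d0 : is_weak_div U k (fun=> 0).
  by apply/is_weak_divP => f tf; rewrite spair0 oppr0; exact: dk.
have hk : Hdiv U k by split => //; exists (fun=> 0); split => //; exact: L2_0.
have wd0 := weak_div_eq U_open U_bounded hk (L2_0 mU muU) d0.
split => //; split => // phi w Lphi Lw g.
have [_ Ldk _] := weak_div_spec hk.
rewrite -/(vpair U k w) -/(spair U _ _) (tk phi w)// add0r.
by rewrite (ae_eq_spair U_open Ldk (L2_0 mU muU) Lphi wd0) spair0.
Qed.

Lemma spaceK0 : K (0 : field).
Proof.
by apply/spaceKP; split => [|f tf|phi w _ _ _]; [exact: L2v0|exact: vpair0|exact: vpair0].
Qed.

Lemma spaceK_lin (z : R[i]) v w : K v -> K w -> K (v + z *: w).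
Proof.
move=> /spaceKP[Lv dv tv] /spaceKP[Lw dw tw]; apply/spaceKP; split.
- exact: L2v_lin.
- move=> f tf; rewrite vpair_lin//; last exact: L2v_cgrad.
  by rewrite dv// dw// mulr0 addr0.
- move=> phi u Lphi Lu g; rewrite vpair_lin//.
  by rewrite (tv phi u)// (tw phi u)// mulr0 addr0.
Qed.

Lemma spaceK_limit (k : nat -> field) k' (C : R) : (forall n, K (k n)) -> L2v U k' ->
  (forall n, Re (mass U (cst 1) (k n - k') (k n - k')) <= C * (4^-1) ^+ n) -> K k'.
Proof.
move=> Kk Lk' hk; have Lk n : L2v U (k n) by have /spaceKP[] := Kk n.
apply/spaceKP; split => // [f tf|phi w Lphi Lw g]; rewrite vpair_mass;
  apply: (mass_ortho_limit U_open Lk Lk' _ hk).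
- by apply: L2v_conj => //; exact: L2v_cgrad.
- by move=> n; rewrite -vpair_mass; have /spaceKP[_ -> //] := Kk n.
- exact: L2v_conj.
- by move=> n; rewrite -vpair_mass; have /spaceKP[_ _ /(_ phi w)->] := Kk n.
Qed.

Lemma mass_le (a b : 'rV[R]_d -> R) (M : R) v : bounded_on U a -> bounded_on U b ->
  (forall x, U x -> a x <= M * b x) -> L2v U v ->
  Re (mass U a v v) <= M * Re (mass U b v v).
Proof.
move=> ba bb ab Lv; rewrite (mass_diag U_open ba Lv) (mass_diag U_open bb Lv) mulr_sumr; apply: ler_sum => i _.
exact: wdot_le.
Qed.

(** [orthogonal_projection] controls the real part of the product only; testing
    against ['i *: w] as well controls the imaginary part. *)
Lemma spaceK_projection v : L2v U v ->
  exists2 k, K k & forall k', K k' -> mass U rho (v - k) k' = 0.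
Proof.
move=> Lv.
have KS : K `<=` (L2v U : set field) by move=> k /spaceKP[].
have rho0 x : U x -> 0 <= rho x by move=> /rho_gt0/ltW.
have [M rhoM] := brho.2.
have complete (k : nat -> field) : (forall n, K (k n)) ->
    (forall n m, (n <= m)%N -> Re (mass U rho (k m - k n) (k m - k n)) <= 4 * (4^-1) ^+ n) ->
    exists k', K k' /\ exists C : R, forall n,
      Re (mass U rho (k n - k') (k n - k')) <= C * (4^-1) ^+ n.
  move=> Kk hk; have Lk n : L2v U (k n) by exact: KS.
  have LB u w : L2v U u -> L2v U w -> L2v U (u - w).
    by move=> Lu Lw; rewrite -scaleN1r; exact: L2v_lin.
  have [n m nm|k' [Lk' [C hC]]] := @L2v_complete _ _ U U_open U_bounded k (m0^-1 * 4) Lk.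
    rewrite -mulrA; apply: le_trans (ler_wpM2l _ (hk n m nm)); last by rewrite invr_ge0 ltW.
    apply: mass_le => //; [exact: b1| |exact: LB].
    by move=> x Ux; rewrite /cst mulrC ler_pdivlMr// mul1r rho_ge.
  exists k'; split; first exact: spaceK_limit hC.
  exists (`|M| * C) => n; rewrite -mulrA; apply: le_trans (ler_wpM2l (normr_ge0 M) (hC n)).
  apply: mass_le => //; [exact: b1| |exact: LB].
  move=> x Ux; rewrite mulr1.
  exact: le_trans (ler_norm _) (le_trans (rhoM x Ux) (ler_norm _)).
have [k Kk hk] := orthogonal_projection (L2v_closed U_open)
  (fun t => @spaceK_lin t%:C) spaceK0 KS
  (re_mass_linear U_open brho) (re_mass_sym U_open brho)
  (re_mass_ge0 U_open brho rho0) complete Lv.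
exists k => // w Kw; apply: complex_eq; first exact: hk.
have Lvk : L2v U (v - k) by rewrite -scaleN1r; apply: L2v_lin => //; exact: KS.
have := hk _ (spaceK_lin 'i spaceK0 Kw).
have Lw : L2v U w := KS w Kw; have L0 := L2v0.
rewrite mass_linr//.
rewrite mass0r add0r re_mul/= mul0r sub0r mulN1r opprK.
exact.
Qed.

Lemma spaceV0 : V (0 : field).
Proof. by have [] := spaceK0. Qed.

Lemma spaceV_lin (z : R[i]) v w : V v -> V w -> V (v + z *: w).
Proof. exact: H0div_lin. Qed.

Lemma spaceKV k : K k -> V k. Proof. by case. Qed.

Lemma divdiv_spaceK a v k : bounded_on U a -> V v -> K k -> divdiv U a v k = 0.
Proof.
by move=> ba Vv [Vk k0]; apply: (divdiv_div0 U_open U_bounded ba _ _ k0); exact: spaceVHdiv.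
Qed.

(** The divergence term of the inner product of V vanishes on [K], so that
    orthogonality to [K] in V and in H coincide. *)
Lemma spaceGP v : V v -> (G v <-> forall k, K k -> mass U rho v k = 0).
Proof.
move=> Vv; split=> [[_ h] k Kk|h].
  by have := h k Kk; rewrite /innerV (divdiv_spaceK brhoc2 Vv Kk) addr0.
by split => // k Kk; rewrite /innerV h// divdiv_spaceK// addr0.
Qed.

Lemma spaceGV v : G v -> V v. Proof. by case. Qed.

Lemma spaceG_lin (z : R[i]) v w : G v -> G w -> G (v + z *: w).
Proof.
move=> Gv Gw; have Vv := spaceGV Gv; have Vw := spaceGV Gw.
apply/spaceGP; first exact: spaceV_lin.
move=> k Kk; have Hv := spaceVH Vv; have Hw := spaceVH Vw; have Hk := spaceVH (spaceKV Kk).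
rewrite mass_lin//.
by rewrite (spaceGP Vv).1// (spaceGP Vw).1// mulr0 addr0.
Qed.

Lemma spaceG0 : G (0 : field).
Proof. by apply/spaceGP; [exact: spaceV0|move=> k _; exact: mass0l]. Qed.

Lemma spaceVZ (z : R[i]) v : V v -> V (z *: v).
Proof. by move=> Vv; rewrite -[z *: v]add0r; exact: (spaceV_lin z spaceV0 Vv). Qed.

Lemma spaceHZ (z : R[i]) v : H v -> H (z *: v).
Proof. by move=> Hv; rewrite -[z *: v]add0r; exact: (L2v_lin U_open z L2v0 Hv). Qed.

Lemma spaceGZ (z : R[i]) v : G v -> G (z *: v).
Proof. by move=> Gv; rewrite -[z *: v]add0r; exact: (spaceG_lin z spaceG0 Gv). Qed.

(** The projection of [v] on [K] is in V, so the remainder is too.  The scalar 1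
    gives the sum the form in which linearity is stated above. *)
Lemma spaceV_decomposition v : V v ->
  exists g k, [/\ G g, K k & v = g + 1 *: k].
Proof.
move=> Vv; have [k Kk hk] := spaceK_projection (spaceVH Vv).
exists (v - k), k; split; [|exact: Kk|by rewrite scale1r subrK].
have Vvk : V (v - k) by rewrite -scaleN1r; apply: spaceV_lin Vv (spaceKV Kk).
exact/(spaceGP Vvk).
Qed.

Lemma massZ a (z : R[i]) v w : bounded_on U a -> H v -> H w ->
  mass U a (z *: v) w = z * mass U a v w.
Proof.
move=> ba Hv Hw; have L0 := L2v0.
by rewrite -[z *: v]add0r mass_lin// mass0l add0r.
Qed.

Lemma divdiv0r a v : bounded_on U a -> V v -> divdiv U a v (0 : field) = 0.
Proof. by move=> ba Vv; exact: (divdiv_spaceK ba Vv spaceK0). Qed.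

Lemma divdiv0l a v : bounded_on U a -> V v -> divdiv U a (0 : field) v = 0.
Proof.
move=> ba Vv; rewrite (divdiv_conj U_open ba (spaceVHdiv Vv) (spaceVHdiv spaceV0)).
by rewrite divdiv0r// rmorph0.
Qed.

Lemma divdivZ a (z : R[i]) v w : bounded_on U a -> V v -> V w ->
  divdiv U a (z *: v) w = z * divdiv U a v w.
Proof.
move=> ba Vv Vw; have hv := spaceVHdiv Vv; have hw := spaceVHdiv Vw; have h0 := spaceVHdiv spaceV0.
by rewrite -[z *: v]add0r divdiv_lin// divdiv0l// add0r.
Qed.

Local Notation sol := (solution_op U rho c nu).
Local Notation ta := (tilde_a U rho c).
Local Notation tb := (tilde_b U rho nu).
Local Notation tG := (tildeG U rho c).
Local Notation "p =ae q" := (ae_pair_eq U p q) (at level 70).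

Definition is_solution f p := tG p /\ forall q, tG q -> ta p q = tb f q.

(** The difference of two solutions is in [tildeG] and is tested against itself.
    Its first component has no divergence, so it is in both [K] and [G]. *)
Lemma is_solution_unique f p p' : is_solution f p -> is_solution f p' -> p =ae p'.
Proof.
move=> [[Gp Hp] hp] [[Gp' Hp'] hp'].
pose e1 := p.1 + (-1) *: p'.1; pose e2 := p.2 + (-1) *: p'.2.
have Ge1 : G e1 by exact: spaceG_lin.
have He2 : H e2 by exact: L2v_lin.
have Ve1 := spaceGV Ge1.
have de := spaceVHdiv Ve1; have dp := spaceVHdiv (spaceGV Gp).
have dp' := spaceVHdiv (spaceGV Gp').
have diffE : ta (e1, e2) (e1, e2) = ta p (e1, e2) + (-1) * ta p' (e1, e2).
  rewrite /tilde_a/= {1}/e1 {1}/e2 divdiv_lin// mass_lin//.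
  by rewrite mulrDr addrACA.
have : ta (e1, e2) (e1, e2) = 0.
  rewrite diffE (hp (e1, e2) (conj Ge1 He2)) (hp' (e1, e2) (conj Ge1 He2)).
  by rewrite mulN1r subrr.
rewrite /tilde_a/= => /(congr1 (@complex.Re R)); rewrite re_add/=.
have d0 : 0 <= Re (divdiv U rc2 e1 e1).
  by apply: wdot_diag_ge0 => // x /rhoc2_gt0/ltW.
have n0 : 0 <= Re (mass U rho e2 e2).
  by apply: mass_diag_ge0 => // x /rho_gt0/ltW.
move=> /eqP; rewrite paddr_eq0// => /andP[/eqP hd /eqP hm].
have [_ Ld _] := weak_div_spec (spaceVHdiv Ve1).
have wd0 := wdot_diag_eq0 mU brhoc2 rhoc2_gt0 Ld hd.
have Ke1 : K e1 by [].
have h1 := (spaceGP Ve1).1 Ge1 e1 Ke1.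
have e10 : {ae mu, forall x, U x -> e1 x = 0}.
  by apply: (mass_diag_eq0 U_open brho rho_gt0 (spaceVH Ve1)); rewrite h1.
have e20 := mass_diag_eq0 U_open brho rho_gt0 He2 hm.
have E v w : {ae mu, forall x, U x -> (v + (-1) *: w : field) x = 0} ->
    {ae mu, forall x, U x -> v x = w x}.
  apply: filterS => x h Ux; apply/eqP; rewrite -subr_eq0 -scaleN1r.
  by apply/eqP; exact: h.
by split; [exact: (E p.1 p'.1 e10)|exact: (E p.2 p'.2 e20)].
Qed.

(** Since [z p] is not zero, the operator returns an actual solution and not its
    default value. *)
Lemma eigenpair_problem z p : z != 0 -> eigenpair U rho c nu z p ->
  problem_solution U rho c nu z^-1 p.
Proof.
move=> z0 [[Vp Hp] nz]; rewrite /solution_op.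
case: xgetP => [s _ [[Gs Hs] hs] e|_ e]; last first.
  case: nz; case: e => e1 e2; split.
    apply: filterS e1 => x h Ux; apply/eqP; have /esym/eqP := h Ux.
    by rewrite scaler_eq0 (negbTE z0).
  apply: filterS e2 => x h Ux; apply/eqP; have /esym/eqP := h Ux.
  by rewrite scaler_eq0 (negbTE z0).
have Vs := spaceGV Gs.
have Hp1 := spaceVH Vp.
have Hs1 := spaceVH Vs.
have H0 : H (0 : field) by exact: L2v0.
have Vzp := spaceVZ z Vp.
have Hzp1 := spaceVH Vzp.
have Hzp := spaceHZ z Hp.
have ms w : H w -> mass U rho s.2 w = z * mass U rho p.2 w.
  move=> Hw; rewrite -(massZ z brho Hp Hw).
  exact: (ae_eq_mass U_open brho Hs Hzp Hw e.2).
have ms1 w : H w -> mass U rho s.1 w = z * mass U rho p.1 w.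
  move=> Hw; rewrite -(massZ z brho Hp1 Hw).
  exact: (ae_eq_mass U_open brho Hs1 Hzp1 Hw e.1).
have ds a w : bounded_on U a -> V w -> divdiv U a s.1 w = z * divdiv U a p.1 w.
  move=> ba Vw; rewrite -(divdivZ z ba Vp Vw).
  exact: (ae_eq_divdiv U_open U_bounded ba (spaceVHdiv Vs) (spaceVHdiv Vzp) (spaceVHdiv Vw) e.1).
have eq2 w : H w -> mass U rho p.2 w = z^-1 * mass U rho p.1 w.
  move=> Hw; have := hs ((0 : field), w) (conj spaceG0 Hw).
  rewrite /tilde_a /tilde_b/= !divdiv0r// mass0r mulr0 subr0 !add0r ms// => <-.
  by rewrite mulrA mulVf// mul1r.
split => // v /spaceV_decomposition[g [k [Gg Kk ->]]].
have Vg := spaceGV Gg; have Vk := spaceKV Kk; have Hk := spaceVH Vk.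
have dg := spaceVHdiv Vg; have dk := spaceVHdiv Vk; have dp := spaceVHdiv Vp.
have Hg := spaceVH Vg.
rewrite !divdiv_linr// mass_linr//.
(* on [K] only the mass term is left, and [s.1] is orthogonal to [K] *)
rewrite (divdiv_spaceK brhoc2 Vp Kk) (divdiv_spaceK bnu Vp Kk) (eq2 k Hk).
have -> : mass U rho p.1 k = 0.
  have := ms1 k Hk; rewrite (spaceGP Vs).1// => /esym/eqP.
  by rewrite mulf_eq0 (negbTE z0) => /eqP.
rewrite !mulr0 !addr0.
have := hs (g, (0 : field)) (conj Gg H0).
rewrite /tilde_a /tilde_b/= !mass0r !addr0 ds// => <-.
by rewrite mulrA mulVf// mul1r.
Qed.

(** Testing the first equation on [K] shows that the first component is in [G];
    the solution is then unique by [is_solution_unique]. *)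
Lemma problem_eigenpair z p : z != 0 -> problem_solution U rho c nu z^-1 p ->
  eigenpair U rho c nu z p.
Proof.
move=> z0 [[Vp Hp] nz eq1 eq2]; split => //.
have Hp1 := spaceVH Vp.
have Gp : G p.1.
  apply/spaceGP => // k Kk; have Vk := spaceKV Kk; have Hk := spaceVH Vk.
  have := eq1 k Vk; rewrite (divdiv_spaceK brhoc2 Vp Kk) (divdiv_spaceK bnu Vp Kk).
  rewrite mulr0 sub0r (eq2 k Hk).
  move=> /esym/eqP; rewrite mulrN oppr_eq0 !mulf_eq0 invr_eq0 (negbTE z0)/=.
  by move=> /eqP.
have s0 : is_solution p (z *: p.1, z *: p.2).
  split; first exact: (conj (spaceGZ z Gp) (spaceHZ z Hp)).
  move=> [v w] [/= Gv Hw]; have Vv := spaceGV Gv.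
  rewrite /tilde_a /tilde_b/= divdivZ// massZ// (eq1 v Vv) (eq2 w Hw).
  by rewrite !mulrA mulfV// !mul1r.
have ssol : is_solution p (sol p) by exact: (xgetPex _ (ex_intro _ _ s0)).
exact: (is_solution_unique ssol s0).
Qed.

End operator_theory.

(** * The eigenvalue correspondence *)

Lemma bounded_on_piecewise (R : realType) (d : nat) (U O1 : set 'rV[R]_d) (a1 a2 : R) :
  measurable O1 -> bounded_on U (piecewise O1 a1 a2).
Proof.
move=> mO; split; last first.
  exists (`|a1| + `|a2|) => x _; rewrite /piecewise; case: ifP => _.
    by rewrite lerDl.
  by rewrite lerDr.
have -> : piecewise O1 a1 a2 = cst a2 \+ (cst (a1 - a2) \* \1_O1).
  apply/funext => x; rewrite /piecewise /= indicE; case: ifP => _ /=.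
    by rewrite mulr1 addrC subrK.
  by rewrite mulr0 addr0.
apply: measurable_funD; first exact: measurable_cst.
by apply: measurable_funM; [exact: measurable_cst|exact: measurable_indic].
Qed.

Theorem lemma2p5 (R : realType) (d : nat) (hd : d = 2%N \/ d = 3%N)
    (Omega1 Omega2 : set 'rV[R]_d)
    (hOmega1 : polyhedral_domain Omega1) (hOmega2 : polyhedral_domain Omega2)
    (hdisj : Omega1 `&` Omega2 = set0)
    (hOmega : lipschitz_domain (glued_domain Omega1 Omega2))
    (hsc1 : simply_connected Omega1) (hsc2 : simply_connected Omega2)
    (hsc : simply_connected (glued_domain Omega1 Omega2))
    (rho1 rho2 c1 c2 nu1 nu2 : R)
    (hrho1 : 0 < rho1) (hrho2 : 0 < rho2) (hc1 : 0 < c1) (hc2 : 0 < c2)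
    (hnu1 : 0 <= nu1) (hnu2 : 0 <= nu2)
    (mu : R[i]) (p : vector_field R d * vector_field R d) :
  (eigenpair (glued_domain Omega1 Omega2) (piecewise Omega1 rho1 rho2)
     (piecewise Omega1 c1 c2) (piecewise Omega1 nu1 nu2) mu p /\ mu <> 0)
  <->
  (exists lambda : R[i], [/\ lambda = 1 / mu, lambda <> 0 &
     problem_solution (glued_domain Omega1 Omega2) (piecewise Omega1 rho1 rho2)
       (piecewise Omega1 c1 c2) (piecewise Omega1 nu1 nu2) lambda p]).
Proof.
have [[U_open _ _ U_bounded] _] := hOmega; have [[[oO1 _ _ _] _] _] := hOmega1.
have mO1 := open_measurable_rV oO1.
have pos a1 a2 x : 0 < a1 -> 0 < a2 -> 0 < piecewise Omega1 a1 a2 x.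
  by move=> h1 h2; rewrite /piecewise; case: ifP.
pose m0 := Num.min rho1 rho2.
have m0_gt0 : 0 < m0 by rewrite lt_min hrho1.
have rho_ge x : glued_domain Omega1 Omega2 x -> m0 <= piecewise Omega1 rho1 rho2 x.
  by rewrite /piecewise; case: ifP => _ _; rewrite ge_min lexx ?orbT.
have rc_gt0 x : glued_domain Omega1 Omega2 x ->
    0 < rhoc2 (piecewise Omega1 rho1 rho2) (piecewise Omega1 c1 c2) x.
  by move=> _; rewrite mulr_gt0 ?exprn_gt0// pos.
have brc : bounded_on (glued_domain Omega1 Omega2)
    (rhoc2 (piecewise Omega1 rho1 rho2) (piecewise Omega1 c1 c2)).
  rewrite (_ : rhoc2 _ _ = piecewise Omega1 (rho1 * c1 ^+ 2) (rho2 * c2 ^+ 2)).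
    exact: bounded_on_piecewise.
  by apply/funext => x; rewrite /rhoc2 /piecewise; case: ifP.
have brho := bounded_on_piecewise (glued_domain Omega1 Omega2) rho1 rho2 mO1.
have bnu := bounded_on_piecewise (glued_domain Omega1 Omega2) nu1 nu2 mO1.
split=> [[ep /eqP mu0]|[lambda [-> + ps]]].
  exists (1 / mu); rewrite div1r; split => //; first by apply/eqP; rewrite invr_eq0.
  exact: (eigenpair_problem U_open U_bounded m0_gt0 rho_ge brho brc bnu mu0 ep).
rewrite div1r in ps * => /eqP; rewrite invr_eq0 => mu0; split; last exact/eqP.
exact: (problem_eigenpair U_open U_bounded m0_gt0 rho_ge rc_gt0 brho brc bnu mu0 ps).
Qed.
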